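(* Let $v,w\in\mathfrak{S}_n$ and let $j_1,\dots,j_m\in\{1,\dots,n-1\}$ be distinct and such that the product $s_{j_1}s_{j_2}\cdots s_{j_m}$ is proper. If $w=vs_{j_1}s_{j_2}\cdots s_{j_m}$ or $w=s_{j_1}s_{j_2}\cdots s_{j_m}v$, with $\ell(w)-\ell(v)=m$, then the Bruhat interval polytope $Q_{v,w}$ is combinatorially equivalent to a cube.
   Context: $\mathfrak{S}_n$ is the symmetric group on $\{1,\dots,n\}$ with product given by composition $(uz)(k)=u(z(k))$, $s_i=(i,i+1)$ are the simple transpositions, $\ell(\cdot)$ is the length with respect to them, and $\le$ is Bruhat order. For $v\le w$, the Bruhat interval polytope $Q_{v,w}$ is the convex hull in $\mathbb{R}^n$ of the points $(z(1),\dots,z(n))$ for $z\in\mathfrak{S}_n$ with $v\le z\le w$. Two polytopes are combinatorially equivalent if their face posets are isomorphic. For $p,q\in\{1,\dots,n-1\}$ set $s(p,q)=s_ps_{p+1}\cdots s_q$ if $p\le q$ and $s(p,q)=s_ps_{p-1}\cdots s_q$ if $p\ge q$; also set $\bar p=\min\{p,q\}$ and $\bar q=\max\{p,q\}$. If $j_1,\dots,j_m$ are distinct, a minimal expression of $s_{j_1}\cdots s_{j_m}$ is an equality $s_{j_1}s_{j_2}\cdots s_{j_m}=s(p_1,q_1)s(p_2,q_2)\cdots s(p_r,q_r)$ in $\mathfrak{S}_n$ where the integer intervals $[\bar p_1,\bar q_1],\dots,[\bar p_r,\bar q_r]$ are pairwise disjoint and $r$ is minimum among all such expressions. Two disjoint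 integer intervals are adjacent if the maximum of one plus $1$ equals the minimum of the other. The product $s_{j_1}\cdots s_{j_m}$ is called proper if, in its minimal expression, no two of the intervals $[\bar p_1,\bar q_1],\dots,[\bar p_r,\bar q_r]$ are adjacent. *)

(* Defs.v *)
From HB Require Import structures.
From mathcomp Require Import all_boot all_order all_fingroup all_algebra.
From mathcomp Require Import classical_sets functions reals.
Set Implicit Arguments.
Unset Strict Implicit.
Unset Printing Implicit Defensive.
Import Order.TTheory GRing.Theory Num.Theory.

Local Open Scope ring_scope.

(* The library multiplies permutations left to right: (s * t)%g k = t (s k).
   [perm_comp] is the composition product, (perm_comp u z) k = u (z k). *)
Definition perm_comp (n : nat) (u z : 'S_n) : 'S_n := (z * u)%g.

Lemma perm_compE (n : nat) (u z : 'S_n) (k : 'I_n) : perm_comp u z k = u (z k).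
Proof. exact: permM. Qed.

Lemma perm_compA (n : nat) : associative (@perm_comp n).
Proof. by move=> x y z; rewrite /perm_comp mulgA. Qed.

Lemma perm_comp1p (n : nat) : left_id 1%g (@perm_comp n).
Proof. by move=> x; rewrite /perm_comp mulg1. Qed.

Lemma perm_compp1 (n : nat) : right_id 1%g (@perm_comp n).
Proof. by move=> x; rewrite /perm_comp mul1g. Qed.

HB.instance Definition _ (n : nat) :=
  Monoid.isLaw.Build 'S_n 1%g (@perm_comp n)
    (@perm_compA n) (@perm_comp1p n) (@perm_compp1 n).

Fact simple_lo_subproof (n : nat) (i : 'I_n.-1) : (i < n)%N.
Proof. exact: leq_trans (ltn_ord i) (leq_pred n). Qed.

Fact simple_hi_subproof (n : nat) (i : 'I_n.-1) : (i.+1 < n)%N.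
Proof. by case: n i => [|n] i; [case: i | exact: ltn_ord i]. Qed.

(* Indices are shifted by one: {1, .., n} is 'I_n and {1, .., n-1} is 'I_n.-1,
   so the ordinal i stands for the simple transposition s_{i+1}. *)
Definition simple_transp (n : nat) (i : 'I_n.-1) : 'S_n :=
  tperm (Ordinal (simple_lo_subproof i)) (Ordinal (simple_hi_subproof i)).

Definition simple_word (n : nat) (j : seq 'I_n.-1) : 'S_n :=
  \big[@perm_comp n/1%g]_(i <- j) simple_transp i.

Lemma simple_word_cat (n : nat) (a b : seq 'I_n.-1) :
  simple_word (a ++ b) = perm_comp (simple_word a) (simple_word b).
Proof. exact: big_cat. Qed.

Lemma simple_word_generates (n : nat) (u : 'S_n) :
  exists j : seq 'I_n.-1, simple_word j = u.
Proof.
pose G (x : 'S_n) := exists j : seq 'I_n.-1, simple_word j = x.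
have GM x y : G x -> G y -> G (x * y)%g.
  by move=> [a <-] [b <-]; exists (b ++ a); rewrite simple_word_cat.
have Gt d (i k : 'I_n) : (k = i + d.+1 :> nat)%N -> G (tperm i k).
  elim: d k => [|d IHd] k Ek.
    have ltin : (i < n.-1)%N.
      by rewrite ltn_predRL; move: (ltn_ord k); rewrite Ek addn1.
    exists [:: Ordinal ltin]; rewrite /simple_word big_seq1 /simple_transp.
    by congr tperm; apply: val_inj; rewrite //= Ek addn1.
  have ltin : (i + d.+1 < n.-1)%N.
    by rewrite ltn_predRL; move: (ltn_ord k); rewrite Ek (addnS i d.+1).
  have ltjn : (i + d.+1 < n)%N by apply: leq_trans ltin (leq_pred _).
  pose j := Ordinal ltjn.
  have Gs : G (tperm j k).
    exists [:: Ordinal ltin]; rewrite /simple_word big_seq1 /simple_transp.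
    by congr tperm; apply: val_inj; rewrite //= Ek !addnS.
  have -> : tperm i k = (tperm j k * (tperm i j * tperm j k))%g.
    have := tpermJ i j (tperm j k); rewrite conjgE tpermV tpermL.
    rewrite tpermD => [-> //||].
      by rewrite -val_eqE /= addnS eq_sym ltn_eqF // ltnS leq_addr.
    by rewrite -val_eqE /= Ek addnS eq_sym ltn_eqF // ltnS leq_addr.
  exact: (GM _ _ Gs (GM _ _ (IHd j erefl) Gs)).
have [ts -> /allP dts] := prod_tpermP u.
rewrite big_seq; apply: (big_ind G) => [|//|[i k] /dts /= neq_ik].
  by exists [::]; rewrite /simple_word big_nil.
have [lt_ik|lt_ki|/val_inj eq_ik] := ltngtP i k.
- by apply: (Gt (k - i.+1)%N); rewrite addnS -addSn subnKC.
- by rewrite tpermC; apply: (Gt (i - k.+1)%N); rewrite addnS -addSn subnKC.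
by rewrite /dpair /= eq_ik eqxx in neq_ik.
Qed.

Fact perm_length_subproof (n : nat) (u : 'S_n) :
  exists k, [exists j : k.-tuple 'I_n.-1, simple_word j == u].
Proof.
have [j <-] := simple_word_generates u.
by exists (size j); apply/existsP; exists (in_tuple j).
Qed.

Definition perm_length (n : nat) (u : 'S_n) : nat :=
  ex_minn (perm_length_subproof u).

Definition bruhat_step (n : nat) : rel 'S_n := fun u w =>
  [exists a : 'I_n, exists b : 'I_n,
    (w == perm_comp u (tperm a b)) && (perm_length u < perm_length w)%N].

Definition bruhat (n : nat) : rel 'S_n := connect (@bruhat_step n).

(* A pair e = (p, q) encodes the factor s(p, q) and the interval
   [min(p, q), max(p, q)]. *)
Definition seg (n : nat) (e : 'I_n.-1 * 'I_n.-1) : seq 'I_n.-1 :=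
  [seq k : 'I_n.-1 <- enum 'I_n.-1 | (minn e.1 e.2 <= k <= maxn e.1 e.2)%N].

Definition mono_run (n : nat) (e : 'I_n.-1 * 'I_n.-1) : 'S_n :=
  simple_word (if (e.1 <= e.2)%N then seg e else rev (seg e)).

Definition adjacent (n : nat) : rel ('I_n.-1 * 'I_n.-1) := fun e f =>
  ((maxn e.1 e.2).+1 == minn f.1 f.2) || ((maxn f.1 f.2).+1 == minn e.1 e.2).

Definition run_expression (n : nat) (u : 'S_n) (es : seq ('I_n.-1 * 'I_n.-1)) :=
  u = \big[@perm_comp n/1%g]_(e <- es) mono_run e /\
  pairwise (fun e f => [disjoint seg e & seg f]) es.

Definition minimal_expression (n : nat) (u : 'S_n)
    (es : seq ('I_n.-1 * 'I_n.-1)) :=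
  run_expression u es /\
  forall es', run_expression u es' -> (size es <= size es')%N.

(* Minimal expressions are not unique, but for a duplicate-free j the choice
   does not matter: one of them has no adjacent intervals only if its intervals
   are the maximal runs of consecutive indices in j, and then the same holds for
   all of them. *)
Definition proper_product (n : nat) (j : seq 'I_n.-1) :=
  exists2 es, minimal_expression (simple_word j) es &
    pairwise (fun e f => ~~ adjacent e f) es.

Local Open Scope classical_set_scope.

Definition conv_hull (R : realType) (V : lmodType R) (A : set V) : set V :=
  [set x : V | exists k (a : 'I_k -> V) (c : 'I_k -> R),
    [/\ forall i, A (a i), forall i, 0 <= c i, \sum_i c i = 1
      & x = \sum_i c i *: a i]].

Definition perm_point (R : realType) (n : nat) (z : 'S_n) : 'rV[R]_n :=
  \row_k (z k).+1%:R.

Definition bruhat_polytope (R : realType) (n : nat) (v w : 'S_n) :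
    set 'rV[R]_n :=
  conv_hull [set perm_point R z | z in [set z | bruhat v z /\ bruhat z w]].
Arguments bruhat_polytope R {n} v w.

(* All faces, including the polytope itself and the empty face. *)
Definition faces (R : realType) (n : nat) (P : set 'rV[R]_n) :
    set (set 'rV[R]_n) :=
  [set F | exists (c : 'rV[R]_n) (b : R),
    (forall x, P x -> \sum_i c 0 i * x 0 i <= b) /\
    F = P `&` [set x : 'rV[R]_n | \sum_i c 0 i * x 0 i = b]].

Definition comb_equiv (R : realType) (n d : nat)
    (P : set 'rV[R]_n) (Q : set 'rV[R]_d) :=
  exists2 f : set 'rV[R]_n -> set 'rV[R]_d, set_bij (faces P) (faces Q) f &
    forall F G, faces P F -> faces P G -> (F `<=` G <-> f F `<=` f G).

Definition cube (R : realType) (d : nat) : set 'rV[R]_d :=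
  [set x : 'rV[R]_d | forall i, 0 <= x 0 i <= 1].
Arguments cube R d : clear implicits.

(* Main.v *)
Require Import Defs.
From mathcomp Require Import all_boot all_order all_fingroup all_algebra.
From mathcomp Require Import classical_sets functions reals.
From mathcomp Require Import boolp zify ring lra.
Set Implicit Arguments.
Unset Strict Implicit.
Unset Printing Implicit Defensive.
Import Order.TTheory GRing.Theory Num.Theory.

(** Right multiplication by a proper product rotates the entries of v inside
    disjoint blocks of consecutive positions, one block per run; left
    multiplication does the same to the inverse of v. Since the product adds its
    number of letters to the length, every letter goes up in weak order, so a
    block that is rotated forward starts with its minimum, and one that is
    rotated backward ends with its maximum ([runs_blocks]). Complementing the
    values and exchanging v and w turns a backward block into a forward one;
    this is what [key] and [base] do.

    Consider one block, with entries f l, ..., f h and least entry f l. The rank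
    counts of Bruhat order ([bruhat_cnt]) trap every element g of the interval
    between f and its rotation: for all x and s,
    #{q < x : f q >= s} <= #{q < x : g q >= s} <= #{q <= x : f q >= s}. Fix a
    position j > l of the block, put t = f j, and let i < j < e be the nearest
    positions on both sides with f i < t and f e < t. In the window from i to
    e - 1 exactly one entry of g lies below t ([pass_spec]); the label of j says
    whether it sits in [j, e) rather than in [i, j). Exchanging this entry with
    the entry t, which sits in the other half ([pivot_spec]), flips the label of
    j and no other label, and moves along a Bruhat relation ([flip_spec]). The
    labels determine g ([label_inj]). Hence the permutations allowed by the
    counts correspond to the 0/1 vectors indexed by the letters of the product,
    and following flips down to v and up to w shows that they are exactly the
    elements of the interval ([in_intervalP]).

    Each letter yields two disjoint facets. The sum of the coordinates over
    [j, e) is at most the sum of f there, with equality iff the label of j is 0;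
    the sum over [i, j) is at most the sum of f over (i, j], with equality iff
    the label is 1 ([right_facetP]). For inverses, sums of positions of the
    same sets of values do this, as an upper bound for label 0 and as a lower
    bound for label 1 ([left_facetP]). The windows form a binary tree in which
    [i, e) splits into [i, j) and [j, e) and whose leaves are the single
    positions; so, at any vertex, the facets through it and the
    constant sums over blocks span all linear functionals ([interval_point],
    [right_span], [left_span]). A functional that is maximal at a vertex is
    therefore a constant minus a combination of the facets through this vertex,
    the neighbours obtained by flips show that the coefficients are nonnegative,
    and the face that it cuts out is a subcube ([face_subcube]). The same holds
    for the standard cube, and the inclusions between subcubes do not depend on
    the polytope ([cubical_comb_equiv]). *)

(** * Rank counts *)

(** For a permutation g and a = 0 these are the rank numbers that characterize
    Bruhat order. *)
Definition cnt (g : nat -> nat) (a b s : nat) : nat :=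
  \sum_(a <= q < b) (s <= g q).

Lemma cnt_cat g a b c s :
  a <= b -> b <= c -> cnt g a c s = cnt g a b s + cnt g b c s.
Proof. by move=> ab bc; rewrite /cnt (big_cat_nat ab bc). Qed.

Lemma cntS g a b s : a <= b -> cnt g a b.+1 s = cnt g a b s + (s <= g b).
Proof. by move=> ab; rewrite /cnt big_nat_recr. Qed.

Lemma cnt_recl g a b s : a < b -> cnt g a b s = (s <= g a) + cnt g a.+1 b s.
Proof. by move=> ab; rewrite /cnt big_ltn. Qed.

Lemma eq_cnt g g' a b s :
  (forall q, a <= q < b -> g q = g' q) -> cnt g a b s = cnt g' a b s.
Proof. by move=> E; apply: eq_big_nat => q /E ->. Qed.

Lemma cnt_le g a b s : cnt g a b s <= b - a.
Proof.
rewrite -[b - a]muln1 -sum_nat_const_nat; apply: leq_sum => q _.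
exact: leq_b1.
Qed.

Lemma cnt_full g a b s :
  (forall q, a <= q < b -> s <= g q) -> cnt g a b s = b - a.
Proof.
move=> H; rewrite -[RHS]muln1 -sum_nat_const_nat.
by apply: eq_big_nat => q /H ->.
Qed.

Lemma cnt_lt g a b p s : a <= p < b -> g p < s -> cnt g a b s < b - a.
Proof.
move=> /andP[ap pb] gp; rewrite (cnt_cat g s ap (ltnW pb)) (@cnt_recl _ p) //.
rewrite (leqNgt s) gp /= add0n.
have := cnt_le g a p s; have := cnt_le g p.+1 b s; lia.
Qed.

Lemma cnt_split g a b t :
  cnt g a b t = \sum_(a <= q < b) (g q == t) + cnt g a b t.+1.
Proof.
rewrite /cnt -big_split; apply: eq_big_nat => q _ /=.
by case: ltngtP.
Qed.

Lemma cnt_gap g a b t :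
  cnt g a b t.+1 < cnt g a b t -> exists2 q, a <= q < b & g q = t.
Proof.
rewrite [X in _ < X]cnt_split -[X in X < _]add0n ltn_add2r lt0n => /eqP nz.
have [/hasP[q]|no] := boolP (has (fun q => g q == t) (index_iota a b)).
  by rewrite mem_index_iota => qab /eqP gq; exists q.
case: nz; apply: big1_seq => q /= qab.
by move/hasPn: no => /(_ q qab) /negbTE ->.
Qed.

Lemma cnt_one g a b t : (cnt g a b t).+1 = b - a ->
  exists p, [/\ a <= p < b, g p < t
             & forall q, a <= q < b -> q != p -> t <= g q].
Proof.
move=> E.
have [/hasP[p]|no] := boolP (has (fun q => g q < t) (index_iota a b)).
  rewrite mem_index_iota => pab gp; exists p; split=> // q qab qp.
  rewrite leqNgt; apply/negP => gq.
  have [ap pb] := andP pab; have := E.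
  rewrite (cnt_cat g t ap (ltnW pb)) (@cnt_recl _ p) // (leqNgt t) gp /= add0n => {}E.
  have [ltqp|leqp] := ltnP q p.
    have qap : a <= q < p by lia.
    have := cnt_lt qap gq; have := cnt_le g p.+1 b t; lia.
  have qpb : p.+1 <= q < b by lia.
  by have := cnt_lt qpb gq; have := cnt_le g a p t; lia.
rewrite cnt_full in E; first by lia.
move=> q qab; rewrite leqNgt; move/hasPn: no; apply.
by rewrite mem_index_iota.
Qed.

(** Two tuples have the same multiset of entries above t as soon as their counts
    agree at every threshold above t; the multiplicity of a value is the
    difference of two consecutive counts. *)
Lemma cnt_sum (k g f : nat -> nat) a b c d t :
  (forall s, t <= s -> cnt g a b s = cnt f c d s) ->
  \sum_(a <= q < b | t <= g q) k (g q) = \sum_(c <= q < d | t <= f q) k (f q).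
Proof.
move=> E.
pose N := (\max_(a <= q < b) g q + \max_(c <= q < d) f q).+1.
have layer (u : nat -> nat) x y : (forall q, x <= q < y -> u q < N) ->
  \sum_(x <= q < y | t <= u q) k (u q) =
  \sum_(t <= v < N) (\sum_(x <= q < y) (u q == v)) * k v.
  move=> uN.
  transitivity (\sum_(x <= q < y) \sum_(t <= v < N) (u q == v) * k v).
    rewrite big_mkcond; apply: eq_big_nat => q /uN uqN.
    case: ifP => tu.
      rewrite (bigD1_seq (u q)) /= ?iota_uniq ?mem_index_iota ?tu //.
      rewrite eqxx mul1n big1 ?addn0 // => v /negbTE.
      by rewrite eq_sym => ->.
    rewrite big1_seq // => v; rewrite mem_index_iota /= => /andP[tv _].
    by case: eqP => // uv; rewrite uv tv in tu.
  by rewrite exchange_big_nat; apply: eq_bigr => v _; rewrite big_distrl.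
rewrite !layer.
- apply: eq_big_nat => v /andP[tv _]; congr (_ * _).
  have := E _ tv; have := E v.+1 (leqW tv).
  by rewrite [cnt g a b v]cnt_split [cnt f c d v]cnt_split => -> /addIn.
- move=> q qcd; rewrite ltnS (leq_trans _ (leq_addl _ _)) //.
  by apply: leq_bigmax_seq; rewrite ?mem_index_iota.
- move=> q qcd; rewrite ltnS (leq_trans _ (leq_addr _ _)) //.
  by apply: leq_bigmax_seq; rewrite ?mem_index_iota.
Qed.

Definition swapn (a b q : nat) : nat :=
  if q == a then b else if q == b then a else q.

Lemma swapnL a b : swapn a b a = b.
Proof. by rewrite /swapn eqxx. Qed.

Lemma swapnR a b : swapn a b b = a.
Proof. by rewrite /swapn eqxx; case: eqP. Qed.

Lemma swapnD a b q : q != a -> q != b -> swapn a b q = q.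
Proof. by rewrite /swapn => /negbTE -> /negbTE ->. Qed.

(** Only the prefixes that contain exactly one of the two swapped positions see
    the swap. The identity is written without subtraction. *)
Lemma cnt_swap g l lo hi x s : l <= lo -> lo < hi ->
  cnt (g \o swapn lo hi) l x s + (lo < x <= hi) * (s <= g lo) =
  cnt g l x s + (lo < x <= hi) * (s <= g hi).
Proof.
move=> llo lohi; set g' := g \o _.
have out a b : (forall q, a <= q < b -> q != lo /\ q != hi) ->
    cnt g' a b s = cnt g a b s.
  move=> H; apply: eq_cnt => q /H[/negbTE n1 /negbTE n2].
  by rewrite /g' /= swapnD ?n1 ?n2.
have glo : g' lo = g hi by rewrite /g' /= swapnL.
have ghi : g' hi = g lo. by rewrite /g' /= swapnR.
have [xlo|lox] := leqP x lo.
  by rewrite out //= => q; lia.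
rewrite !(cnt_cat _ s llo (ltnW lox)) !(@cnt_recl _ lo) // glo.
rewrite (out l lo); last by move=> q; lia.
have [xhi|hix] := leqP x hi.
  by rewrite (out lo.+1 x) /=; [lia | move=> q; lia].
rewrite !(@cnt_cat _ lo.+1 hi x) // ?(ltnW hix) // !(@cnt_recl _ hi) // ghi.
rewrite (out lo.+1 hi); last by move=> q; lia.
rewrite (out hi.+1 x); last by move=> q; lia.
rewrite /=; lia.
Qed.

(** * Labels of one rotated block *)

Fixpoint last_below (f : nat -> nat) (t x : nat) : nat :=
  if x is x'.+1 then if f x' < t then x' else last_below f t x' else 0.

(** [prev_smaller f j] and [next_smaller f h j] bound the largest window around j
    on which f is at least f j. When no smaller value follows in the block, the
    second one is h.+1. *)
Definition prev_smaller f j := last_below f (f j) j.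

Definition next_smaller f h j := j.+1 + find (fun q => f q < f j) (iota j.+1 (h - j)).

(** The upper bound is the rank count of the rotated block f (l+1), ..., f h, f l
    for thresholds above f l; for smaller thresholds it holds trivially. *)
Record admissible (l h : nat) (f g : nat -> nat) : Prop := Admissible {
  adm_ge : forall x s, l <= x <= h -> cnt f l x s <= cnt g l x s;
  adm_le : forall x s, l <= x <= h -> cnt g l x s <= cnt f l x.+1 s;
  adm_eq : forall s, cnt g l h.+1 s = cnt f l h.+1 s }.

Lemma eq_admissible l h f g g' : (forall q, l <= q <= h -> g q = g' q) ->
  admissible l h f g -> admissible l h f g'.
Proof.
move=> E [ge le eq]; split=> [x s xlh|x s xlh|s].
- by rewrite -(@eq_cnt g g') ?ge // => q ?; apply: E; lia.
- by rewrite -(@eq_cnt g g') ?le // => q ?; apply: E; lia.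
by rewrite -eq; apply: eq_cnt => q ?; rewrite E //; lia.
Qed.

(** Both bounds of [admissible] leave two possible values to the count of g at j
    with threshold f j: that of f, or one more. *)
Definition label (l : nat) (f g : nat -> nat) (j : nat) : bool :=
  cnt f l j (f j) < cnt g l j (f j).

Lemma eq_label l f g g' j : (forall q, l <= q < j -> g q = g' q) ->
  label l f g j = label l f g' j.
Proof. by move=> E; rewrite /label (eq_cnt _ E). Qed.

Section Block.

Variables (l h : nat) (f : nat -> nat).
Hypothesis f_inj : forall p q, l <= p <= h -> l <= q <= h -> f p = f q -> p = q.
Hypothesis f_min : forall q, l < q <= h -> f l < f q.

Lemma prev_smaller_spec j : l < j <= h ->
  [/\ l <= prev_smaller f j < j, f (prev_smaller f j) < f j
    & forall q, prev_smaller f j < q < j -> f j < f q].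
Proof.
move=> jlh; rewrite /prev_smaller.
suff: forall x, l < x <= j ->
    [/\ l <= last_below f (f j) x < x, f (last_below f (f j) x) < f j
      & forall q, last_below f (f j) x < q < x -> f j < f q].
  by apply; lia.
elim=> [|x IH] /= xlj; first by lia.
case: ifP => fx; first by split=> //; lia.
have lx : l < x.
  rewrite ltnNge; apply/negP => xl.
  have ex : x = l by lia.
  by rewrite ex f_min in fx.
have [] := IH; first by lia.
move=> le lt gt; split=> // [|q]; first by lia.
rewrite ltnS => /andP[lq qx]; have [->|nqx] := eqVneq q x.
  have := f_inj (p := x) (q := j); lia.
by apply: gt; lia.
Qed.

Lemma next_smaller_spec j : l < j <= h ->
  [/\ j < next_smaller f h j <= h.+1,
      next_smaller f h j <= h -> f (next_smaller f h j) < f j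
    & forall q, j < q < next_smaller f h j -> f j < f q].
Proof.
move=> jlh; rewrite /next_smaller; set P := fun q => _; set s := iota _ _.
have szs : size s = h - j by rewrite size_iota.
have fs : find P s <= h - j by rewrite -szs find_size.
split; first by lia.
  move=> leh; have fs' : find P s < h - j by lia.
  have : P (nth 0 s (find P s)) by rewrite nth_find // has_find szs.
  by rewrite nth_iota.
move=> q qjs.
have qs : q - j.+1 < find P s by lia.
have := before_find 0 qs; rewrite nth_iota; last by lia.
rewrite subnKC; last by lia.
rewrite /P; have := f_inj (p := q) (q := j); lia.
Qed.

Section Label.

Variable g : nat -> nat.
Hypothesis g_adm : admissible l h f g.
Variable j : nat.
Hypothesis jlh : l < j <= h.

Let i := prev_smaller f j.
Let e := next_smaller f h j.
Let t := f j.
Let b := label l f g j.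

Let Hi : l <= i < j. Proof. by case: (prev_smaller_spec jlh). Qed.
Let fi : f i < t. Proof. by case: (prev_smaller_spec jlh). Qed.
Let f_ij q : i < q < j -> t < f q.
Proof. by case: (prev_smaller_spec jlh) => _ _; apply. Qed.
Let He : j < e <= h.+1. Proof. by case: (next_smaller_spec jlh). Qed.
Let fe : e <= h -> f e < t. Proof. by case: (next_smaller_spec jlh). Qed.
Let f_je q : j < q < e -> t < f q.
Proof. by case: (next_smaller_spec jlh) => _ _; apply. Qed.

Let f_ie q : i < q < e -> t <= f q.
Proof.
move=> /andP[iq qe]; case: (ltngtP q j) => [qj|jq|->//].
  by apply/ltnW/f_ij/andP.
by apply/ltnW/f_je/andP.
Qed.

(** The entry of f at i is below t, so for thresholds s >= t the two bounds of
    [admissible] coincide at i, and likewise at e. *)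
Lemma cnt_prev_smaller s : t <= s -> cnt g l i s = cnt f l i s.
Proof.
move=> ts; apply/eqP; rewrite eqn_leq (adm_ge g_adm) ?andbT; last by lia.
have := adm_le g_adm s (x := i); rewrite cntS; last by lia.
by rewrite [s <= f i]leqNgt (leq_trans fi ts) addn0; apply; lia.
Qed.

Lemma cnt_next_smaller s : t <= s -> cnt g l e s = cnt f l e s.
Proof.
move=> ts; have [eh|he] := leqP e h; last first.
  by have -> : e = h.+1 by [lia]; rewrite (adm_eq g_adm).
apply/eqP; rewrite eqn_leq (adm_ge g_adm) ?andbT; last by lia.
have := adm_le g_adm s (x := e); rewrite cntS; last by lia.
rewrite [s <= f e]leqNgt (leq_trans (fe eh) ts) addn0; apply; lia.
Qed.

Lemma cnt_pivot s : t <= s -> cnt g l j s = cnt f l j s + (b && (s == t)).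
Proof.
move=> ts; have := adm_ge g_adm s (x := j).
have := adm_le g_adm s (x := j); rewrite cntS; last by lia.
rewrite /b /label -/t; have [->|nst] := eqVneq s t.
  by have := adm_ge g_adm t (x := j); lia.
have -> : (s <= f j) = false by apply/negbTE; rewrite -ltnNge ltn_neqAle eq_sym nst.
by rewrite andbF; lia.
Qed.

(** Above t, the entries of g in [i, j) are those of f in (i, j) if the label is 0
    and those of f in (i, j] if it is 1: the label moves the entry t from the
    right half of the window to the left one. *)
Lemma cnt_left s : t <= s -> cnt g i j s = cnt f i.+1 (j + b) s.
Proof.
move=> ts; have ij : i <= j by lia.
have li : l <= i by lia.
have := cnt_pivot ts; rewrite !(cnt_cat _ _ li ij) cnt_prev_smaller //.
rewrite (@cnt_recl f i j); last by lia.
rewrite [s <= f i]leqNgt (leq_trans fi ts) add0n -addnA => /addnI ->.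
case: b => /=; last by rewrite !addn0.
rewrite addn1 cntS; last by lia.
by rewrite -/t eqn_leq ts andbT.
Qed.

Lemma cnt_right s : t <= s -> cnt g j e s = cnt f (j + b) e s.
Proof.
move=> ts; have je : j <= e by lia.
have lj : l <= j by lia.
have := cnt_next_smaller ts; rewrite !(cnt_cat _ _ lj je) cnt_pivot // -addnA => /addnI.
case: b => /=; last by rewrite !addn0.
rewrite addn1 (@cnt_recl f j e); last by lia.
rewrite -/t eqn_leq ts andbT; lia.
Qed.

Lemma cnt_left_full : (cnt g i j t) = j + b - i.+1.
Proof.
rewrite cnt_left //; apply: cnt_full => q; case: b; last by move=> ?; apply: f_ie; lia.
by move=> ?; apply: f_ie; lia.
Qed.

Lemma cnt_right_full : (cnt g j e t) = e - (j + b).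
Proof. by rewrite cnt_right //; apply: cnt_full => q ?; apply: f_ie; lia. Qed.

Lemma sum_left (k : nat -> nat) :
  \sum_(i <= q < j | t <= g q) k (g q) = \sum_(i.+1 <= q < j + b) k (f q).
Proof.
rewrite (cnt_sum k cnt_left) [LHS]big_nat_cond [RHS]big_nat_cond.
apply: eq_bigl => q; rewrite andbT; apply: andb_idr => /andP[iq qj].
by apply: f_ie; case: (b) qj; lia.
Qed.

Lemma sum_right (k : nat -> nat) :
  \sum_(j <= q < e | t <= g q) k (g q) = \sum_(j + b <= q < e) k (f q).
Proof.
rewrite (cnt_sum k cnt_right) [LHS]big_nat_cond [RHS]big_nat_cond.
apply: eq_bigl => q; rewrite andbT; apply: andb_idr => /andP[iq qj].
by apply: f_ie; lia.
Qed.

(** By the two full counts, the window lacks exactly one entry above t, in the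
    half that the label designates. *)
Lemma pass_spec : exists p,
  [/\ i <= p < e, b = (j <= p), g p < t
    & forall q, i <= q < e -> q != p -> t <= g q].
Proof.
have ij : i <= j by lia. have je : j <= e by lia.
have [] := @cnt_one g i e t.
  rewrite (cnt_cat _ _ ij je) cnt_left_full cnt_right_full.
  by case: (b); lia.
move=> p [pie gp gq]; exists p; split=> //.
have := cnt_left_full; have := cnt_right_full.
case: (leqP j p) => [jp|pj].
  have := @cnt_lt g j e p t; case: (b) => //; lia.
have := @cnt_lt g i j p t; case: (b) => //; lia.
Qed.

(** The counts at t and t.+1 differ in the half that received the entry t. *)
Lemma pivot_spec : exists q, [/\ i <= q < e, b = (q < j) & g q = t].
Proof.
case Eb: b.
  have [|q qij gq] := @cnt_gap g i j t.
    have ij : i.+1 <= j by lia.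
    rewrite !cnt_left // Eb !addn1 !(cntS _ _ ij).
    rewrite -/t leqnn ltnn addn0 addn1 ltnS /cnt leq_sum // => q _.
    by case: ltnP => // /ltnW ->.
  by exists q; split=> //; lia.
have [|q qij gq] := @cnt_gap g j e t.
  have je : j < e by lia.
  rewrite !cnt_right // Eb !addn0 !(cnt_recl _ _ je).
  rewrite -/t leqnn ltnn add0n add1n ltnS /cnt leq_sum // => q _.
  by case: ltnP => // /ltnW ->.
by exists q; split=> //; lia.
Qed.

(** The exchanged values are t and a smaller one, p < t. A threshold s in (p, t]
    is at most every f q with i < q < e, so between the two positions the counts
    of g are at least one step away from the bound towards which the exchange
    moves them. A label j' could change only if f j' lay in (p, t] with j'
    between the two positions, and j is the only such place. *)
Lemma flip_spec : exists lo hi,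
  [/\ l <= lo, lo < hi <= h, (if b then g hi < g lo else g lo < g hi),
      admissible l h f (g \o swapn lo hi)
    & forall j', l < j' <= h ->
        label l f (g \o swapn lo hi) j' = label l f g j' (+) (j' == j)].
Proof.
have [p [pie bp gp gq]] := pass_spec.
have [r [rie br gr]] := pivot_spec.
pose lo := if b then r else p; pose hi := if b then p else r.
have Hlo : i <= lo < j by rewrite /lo; case: (b) bp br; lia.
have Hhi : j <= hi < e by rewrite /hi; case: (b) bp br; lia.
have llo : l <= lo by lia. have lohi : lo < hi by lia.
have sw x s := cnt_swap g x s llo lohi.
have glo : g lo = if b then t else g p by rewrite /lo; case: (b).
have ghi : g hi = if b then g p else t by rewrite /hi; case: (b).
(* no f q with lo < q <= hi lies strictly between the two exchanged values *)
have mid q : lo < q <= hi -> t <= f q by move=> ?; apply: f_ie; lia.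
exists lo, hi; split; [by lia | by lia | | |].
- by rewrite glo ghi; case: (b).
- split=> [x s xlh|x s xlh|s].
  + have := sw x s; have := adm_ge g_adm s xlh; rewrite glo ghi.
    case: (ltnP lo x) => [lox|_]; last by rewrite /= ?mul0n ?addn0; lia.
    case: (leqP x hi) => [xhi|_]; last by rewrite /= ?mul0n ?addn0; lia.
    rewrite /= !mul1n; case Eb: (b) => /=; last by case: (leqP s t) (leqP s (g p)); lia.
    case: (leqP s (g p)) => [sp|ps]; first by lia.
    case: (leqP s t) => [st|ts]; last by lia.
    have lx : l <= x by lia. have xe : x <= e by lia.
    have Le : cnt f l e s <= cnt g l e s.
      have [eh|he] := leqP e h; first by apply: (adm_ge g_adm); lia.
      have -> : e = h.+1 by lia.
      by rewrite (adm_eq g_adm).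
    have := @cnt_lt g x e p s; have pE : p = hi by rewrite /hi Eb.
    have := @cnt_full f x e s.
    move: Le; rewrite !(cnt_cat _ s lx xe) => Le full lt.
    rewrite full in Le; last by move=> q ?; apply: leq_trans st _; apply: f_ie; lia.
    by move: lt; lia.
  + have := sw x s; have := adm_le g_adm s xlh; rewrite glo ghi.
    case: (ltnP lo x) => [lox|_]; last by rewrite /= ?mul0n ?addn0; lia.
    case: (leqP x hi) => [xhi|_]; last by rewrite /= ?mul0n ?addn0; lia.
    rewrite /= !mul1n; case Eb: (b) => /=; first by case: (leqP s t) (leqP s (g p)); lia.
    case: (leqP s (g p)) => [sp|ps]; first by lia.
    case: (leqP s t) => [st|ts]; last by lia.
    have li : l <= i by lia. have ix : i <= x by lia.
    have pE : p = lo by rewrite /lo Eb.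
    have := @cnt_lt g i x p s; have := @cnt_full f i.+1 x.+1 s.
    have := adm_le g_adm s (x := i).
    rewrite (cnt_cat g s li ix) (@cnt_cat f l i.+1 x.+1 s); [|lia|lia].
    move=> Li full lt; rewrite full; first by move: Li lt; lia.
    by move=> q ?; apply: leq_trans st _; apply: f_ie; lia.
  have := sw h.+1 s; rewrite (adm_eq g_adm).
  have -> : (h < hi) = false by lia.
  by rewrite andbF !mul0n !addn0.
move=> j' j'lh; have := sw j' (f j').
have [->|nj] := eqVneq j' j.
  rewrite glo ghi !(fun_if (leq t)); have -> : lo < j <= hi by lia.
  rewrite !mul1n addbT -/b /label -/t; have := cnt_pivot (leqnn t).
  have -> : (t <= g p) = false by lia.
  by rewrite eqxx andbT; case: (b) => /=; lia.
rewrite addbF /label.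
case: (ltnP lo j') => [loj|_]; last by rewrite /= ?mul0n ?addn0 => ->.
case: (leqP j' hi) => [jhi|_]; last by rewrite /= ?mul0n ?addn0 => ->.
have ltj : t < f j'.
  have := mid j'; rewrite loj jhi ltn_neqAle => -> //; rewrite andbT.
  by apply/eqP => Et; case/eqP: nj; apply: f_inj; rewrite -?Et //; lia.
have -> : (f j' <= g lo) = false by rewrite glo; case: (b); lia.
have -> : (f j' <= g hi) = false by rewrite ghi; case: (b); lia.
by rewrite !mul1n !addn0 => ->.
Qed.

(** Separates the contribution of the only entry of the window below t. *)
Lemma sum_pass a c (F : nat -> nat) : (forall q, a <= q < c -> i <= q < e) ->
  exists2 p, [/\ i <= p < e, g p < t & b = (j <= p)] &
    \sum_(a <= q < c) F q =
    \sum_(a <= q < c | t <= g q) F q + (a <= p < c) * F p.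
Proof.
move=> ac; have [p [pie bp gp gq]] := pass_spec; exists p => //.
rewrite (bigID (fun q => t <= g q)) /=; congr (_ + _).
have [pac|npac] := boolP (a <= p < c); last first.
  rewrite big_nat_cond big1 // => q /andP[qac]; rewrite gq ?ac //.
  by apply: contraNneq npac => <-.
rewrite big_mkcond (bigD1_seq p) ?mem_index_iota ?iota_uniq //=.
rewrite leqNgt gp mul1n /= big1_seq ?addn0 // => q.
by rewrite mem_index_iota => /andP[qp qac]; rewrite gq ?ac.
Qed.

Lemma sum_right_eq (k : nat -> nat) : ~~ b ->
  \sum_(j <= q < e) k (g q) = \sum_(j <= q < e) k (f q).
Proof.
move=> nb; have [q|p [pie gp bp] ->] := @sum_pass j e (k \o g); first by lia.
by rewrite (sum_right k) -bp (negbTE nb) mul0n !addn0.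
Qed.

Lemma sum_left_eq (k : nat -> nat) : b ->
  \sum_(i <= q < j) k (g q) = \sum_(i.+1 <= q < j.+1) k (f q).
Proof.
move=> sb; have [q|p [pie gp bp] ->] := @sum_pass i j (k \o g); first by lia.
by rewrite (sum_left k) sb addn1 ltnNge -bp sb andbF mul0n addn0.
Qed.

(** The facet inequality of label 0. When the label is 1, the right half has lost
    its entry t to a smaller one, so the sum drops; [sum_left_key] is the mirror
    statement, for the rotated block. *)
Lemma sum_right_key :
  \sum_(j <= q < e) g q <= \sum_(j <= q < e) f q ?= iff ~~ b.
Proof.
have [q|p [pie gp bp] ->] := @sum_pass j e g; first by lia.
apply/leqifP; rewrite (sum_right id) /=; case: (b) bp => /= bp; last first.
  by rewrite addn0 -bp mul0n addn0.
rewrite addn1 [X in _ < X]big_ltn; last by lia.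
by rewrite addnC -/t -bp; case: (p < e); rewrite /= ?mul1n ?mul0n; lia.
Qed.

Lemma sum_left_key :
  \sum_(i <= q < j) g q <= \sum_(i.+1 <= q < j.+1) f q ?= iff b.
Proof.
have [q|p [pie gp bp] ->] := @sum_pass i j g; first by lia.
apply/leqifP; rewrite (sum_left id) /=; case: (b) bp => /= bp.
  by rewrite addn1 ltnNge -bp andbF mul0n addn0.
rewrite addn0 big_nat_recr /=; last by lia.
by rewrite ltn_add2l -/t; case: (_ && _); rewrite /= ?mul1n ?mul0n; lia.
Qed.

Section Positions.

Variable pos : nat -> nat.
Hypothesis posK : forall q, l <= q <= h -> pos (g q) = q.

(** The same facet for the inverse permutation: now the positions of the values
    that f takes on [j, e) are summed. If the label is 1, the value t sits in the
    left half and leaves a place of the right half to an entry that is not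
    counted, so the sum is below the sum of all positions of this half. *)
Lemma sum_right_pos :
  \sum_(j <= q < e) pos (f q) <= \sum_(j <= q < e) q ?= iff ~~ b.
Proof.
have -> : \sum_(j <= q < e) q = \sum_(j <= q < e) pos (g q).
  by apply: eq_big_nat => q ?; rewrite posK //; lia.
have [q|p [pie gp bp] ->] := @sum_pass j e (pos \o g); first by lia.
apply/leqifP; rewrite /= (sum_right pos) /=.
have [r [rie br gr]] := pivot_spec.
case: (b) bp br => /= bp br; last by rewrite addn0 -bp mul0n addn0.
rewrite addn1 [X in X < _]big_ltn; last by lia.
rewrite addnC ltn_add2l -/t -gr posK; last by lia.
have -> : j <= p < e by lia.
by rewrite mul1n posK; lia.
Qed.

Lemma sum_left_pos :
  \sum_(i <= q < j) q <= \sum_(i.+1 <= q < j.+1) pos (f q) ?= iff b.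
Proof.
have -> : \sum_(i <= q < j) q = \sum_(i <= q < j) pos (g q).
  by apply: eq_big_nat => q ?; rewrite posK //; lia.
have [q|p [pie gp bp] ->] := @sum_pass i j (pos \o g); first by lia.
apply/leqifP; rewrite /= (sum_left pos) /=.
have [r [rie br gr]] := pivot_spec.
case: (b) bp br => /= bp br.
  by rewrite addn1 ltnNge -bp andbF mul0n addn0.
rewrite addn0 [X in _ < X]big_nat_recr /=; last by lia.
rewrite ltn_add2l -/t -gr posK; last by lia.
have -> : i <= p < j by lia.
by rewrite mul1n posK; lia.
Qed.

End Positions.

End Label.

Lemma prev_smallerE j i : l < j <= h -> l <= i < j -> f i < f j ->
  (forall q, i < q < j -> f j < f q) -> prev_smaller f j = i.
Proof.
move=> jlh lij fi gt; have [lp fp gt'] := prev_smaller_spec jlh.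
case: (ltngtP (prev_smaller f j) i) => // lt.
  by have := gt' i; lia.
by have := gt (prev_smaller f j); lia.
Qed.

Lemma next_smallerE j e : l < j <= h -> j < e <= h.+1 -> (e <= h -> f e < f j) ->
  (forall q, j < q < e -> f j < f q) -> next_smaller f h j = e.
Proof.
move=> jlh jeh fe gt; have [jn fn gt'] := next_smaller_spec jlh.
case: (ltngtP (next_smaller f h j) e) => // lt.
  by have := gt (next_smaller f h j); lia.
by have := gt' e; lia.
Qed.

Section Intervals.

Variable Q : nat -> nat -> Prop.
Hypothesis Q_prefix : forall a b c, a <= b <= c -> Q a c -> Q b c -> Q a b.
Hypothesis Q_suffix : forall a b c, a <= b <= c -> Q a c -> Q a b -> Q b c.
Hypothesis Q_block : Q l h.+1.
Hypothesis Q_half : forall j, l < j <= h ->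
  Q j (next_smaller f h j) \/ Q (prev_smaller f j) j.

(** Induction on f j. If [i, e) is not the whole block, then it is one of the
    two halves of the window of i or of e, whichever carries the larger value (or
    is not an end of the block). *)
Lemma interval_halves j : l < j <= h ->
  Q (prev_smaller f j) j /\ Q j (next_smaller f h j).
Proof.
have [N] := ubnP (f j); elim: N j => // N IH j fjN jlh.
have [lij fi gti] := prev_smaller_spec jlh; have [jeh fe gte] := next_smaller_spec jlh.
set i := prev_smaller f j in lij fi gti *; set e := next_smaller f h j in jeh fe gte *.
have gt q : i < q < e -> f j <= f q.
  move=> /andP[iq qe]; case: (ltngtP q j) => [qj|jq|->//].
    by apply/ltnW/gti/andP.
  by apply/ltnW/gte/andP.
have Qie : Q i e.
  have [il|nil] := eqVneq i l; have [eh|neh] := eqVneq e h.+1.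
  - by rewrite il eh.
  - have elh : l < e <= h by lia.
    have ie : f i < f e by rewrite il; apply: f_min.
    have <- : prev_smaller f e = i.
      apply: prev_smallerE => //; first by lia.
      by move=> q ?; apply: leq_trans (gt q _); [apply: fe; lia | lia].
    by apply: (IH e _ elh).1; have := fe; lia.
  - have ilh : l < i <= h by lia.
    have <- : next_smaller f h i = e.
      apply: next_smallerE => //; [by lia | by lia|].
      by move=> q ?; apply: leq_trans (gt q _); [|lia].
    by apply: (IH i _ ilh).2; lia.
  have ilh : l < i <= h by lia. have elh : l < e <= h by lia.
  have [ie|ei] := ltnP (f i) (f e).
    have <- : prev_smaller f e = i.
      apply: prev_smallerE => //; first by lia.
      by move=> q ?; apply: leq_trans (gt q _); [apply: fe; lia | lia].
    by apply: (IH e _ elh).1; have := fe; lia.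
  have <- : next_smaller f h i = e.
    apply: next_smallerE => //; first by lia.
      by move=> _; have := f_inj (p := i) (q := e); lia.
    by move=> q ?; apply: leq_trans (gt q _); [|lia].
  by apply: (IH i _ ilh).2; lia.
have ije : i <= j <= e by lia.
have [Qje|Qij] := Q_half jlh; split=> //.
  exact: Q_prefix ije Qie Qje.
exact: Q_suffix ije Qie Qij.
Qed.

(** A single position p is a half of the window of p or of p + 1, according to
    which of the two carries the larger value. *)
Lemma interval_point p : l <= p <= h -> Q p p.+1.
Proof.
move=> plh; have [ph|ph] := eqVneq p h.
  have [hl|hl] := eqVneq p l; first by have := Q_block; rewrite -ph hl.
  have jlh : l < p <= h by lia.
  have [_] := interval_halves jlh; rewrite (_ : next_smaller _ _ _ = p.+1) //.
  by apply: next_smallerE => //; lia.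
have [lt|gt] := ltnP (f p) (f p.+1).
  have jlh : l < p.+1 <= h by lia.
  have [+ _] := interval_halves jlh; rewrite (_ : prev_smaller _ _ = p) //.
  by apply: prev_smallerE => //; lia.
have [pl|pl] := eqVneq p l; first by have := @f_min p.+1; rewrite -pl; lia.
have jlh : l < p <= h by lia.
have [_] := interval_halves jlh; rewrite (_ : next_smaller _ _ _ = p.+1) //.
apply: next_smallerE => //; [by lia | | by lia].
by move=> _; have := f_inj (p := p) (q := p.+1); lia.
Qed.

End Intervals.

Lemma sum_block (k g : nat -> nat) : admissible l h f g ->
  \sum_(l <= q < h.+1) k (g q) = \sum_(l <= q < h.+1) k (f q).
Proof.
move=> g_adm; have := @cnt_sum k g f l h.+1 l h.+1 0.
by apply => s _; apply: adm_eq.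
Qed.

(** Equal labels give equal sums on the designated half of every window, hence on
    every single position. *)
Lemma label_inj g g' : admissible l h f g -> admissible l h f g' ->
  (forall j, l < j <= h -> label l f g j = label l f g' j) ->
  forall p, l <= p <= h -> g p = g' p.
Proof.
move=> ga ga' E p plh.
suff: \sum_(p <= q < p.+1) g q = \sum_(p <= q < p.+1) g' q.
  by rewrite !big_nat1.
apply: (@interval_point (fun a b =>
  \sum_(a <= q < b) g q = \sum_(a <= q < b) g' q)) => //.
- move=> a b c /andP[ab bc]; rewrite !(big_cat_nat ab bc) /= => + Ebc.
  by rewrite Ebc => /addIn.
- move=> a b c /andP[ab bc]; rewrite !(big_cat_nat ab bc) /= => + Eab.
  by rewrite Eab => /addnI.
- by rewrite (sum_block id ga) (sum_block id ga').
move=> j jlh; case L: (label l f g j); have L' := L; rewrite E // in L'.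
  right; have [_ ] := sum_left_key ga jlh; have [_] := sum_left_key ga' jlh.
  by rewrite L L' => /eqP -> /eqP ->.
left; have [_ ] := sum_right_key ga jlh; have [_] := sum_right_key ga' jlh.
by rewrite L L' => /eqP -> /eqP ->.
Qed.

Lemma admissible_refl : admissible l h f f.
Proof.
by split=> // x s xlh; rewrite cntS ?leq_addr //; case/andP: xlh.
Qed.

Lemma label_refl j : label l f f j = false.
Proof. by rewrite /label ltnn. Qed.

Section Rotation.

Variable g : nat -> nat.
Hypothesis g_shift : forall p, l <= p < h -> g p = f p.+1.
Hypothesis g_last : g h = f l.

Let cnt_shift x s : l <= x <= h -> cnt g l x s = cnt f l.+1 x.+1 s.
Proof.
move=> xlh; rewrite /cnt big_add1 /=; apply: eq_big_nat => p ?.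
by rewrite g_shift //; lia.
Qed.

Let cnt_shiftl x s : l <= x <= h ->
  cnt f l x.+1 s = (s <= f l) + cnt g l x s.
Proof. by move=> xlh; rewrite cnt_shift // cnt_recl // ltnS; case/andP: xlh. Qed.

(** The other end of the interval: the rotated block is admissible and has all
    labels 1, whereas f itself has all labels 0. *)
Lemma admissible_rotation : l <= h -> admissible l h f g.
Proof.
move=> lh; split=> [x s xlh|x s xlh|s].
- have := cnt_shiftl s xlh; rewrite cntS; last by lia.
  suff : (s <= f l) <= (s <= f x).
    move: (nat_of_bool (s <= f l)) (nat_of_bool (s <= f x)) => A B; lia.
  have [->//|xl] := eqVneq x l; case: (leqP s (f l)) => // sl.
  by rewrite (leq_trans sl) //; apply/ltnW/f_min; lia.
- by rewrite cnt_shiftl // leq_addl.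
by rewrite cntS // g_last cnt_shiftl 1?addnC // leqnn andbT.
Qed.

Lemma label_rotation j : l < j <= h -> label l f g j.
Proof.
move=> jlh; have := @cnt_shiftl j (f j); rewrite cntS; last by lia.
have := f_min jlh; rewrite /label leqnn ltnNge => /negbTE ->; lia.
Qed.

End Rotation.

End Block.

(** * Length and Bruhat order by exchange *)

Section Perm.

Variable n : nat.
Implicit Types (u v w z : 'S_n) (ws : seq 'I_n.-1) (p q : nat).

(** Permutations as functions on nat, fixing everything beyond n, so that prefixes
    and blocks need no ordinals. *)
Definition ev u p : nat := if insub p is Some i then val (u i) else p.

Lemma evE u (i : 'I_n) : ev u i = u i.
Proof. by rewrite /ev valK. Qed.

Lemma ev_out u p : n <= p -> ev u p = p.
Proof. by move=> np; rewrite /ev insubF // ltnNge np. Qed.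

Lemma ev_lt u p : (ev u p < n) = (p < n).
Proof.
have [pn|np] := ltnP p n; first by rewrite -[p]/(val (Ordinal pn)) evE ltn_ord.
by rewrite ev_out // ltnNge np.
Qed.

Lemma ev_comp u z p : ev (perm_comp u z) p = ev u (ev z p).
Proof.
have [pn|np] := ltnP p n; last by rewrite !ev_out.
by rewrite -[p]/(val (Ordinal pn)) !evE perm_compE.
Qed.

Lemma ev1 p : ev 1 p = p.
Proof.
have [pn|np] := ltnP p n; last by rewrite !ev_out.
by rewrite -[p]/(val (Ordinal pn)) !evE perm1.
Qed.

Lemma evK u : cancel (ev u) (ev u^-1).
Proof. by move=> p; rewrite -ev_comp /perm_comp mulgV ev1. Qed.

Lemma evKV u : cancel (ev u^-1) (ev u).
Proof. by move=> p; rewrite -ev_comp /perm_comp mulVg ev1. Qed.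

Lemma ev_inj u : injective (ev u).
Proof. exact: can_inj (evK u). Qed.

Lemma ev_tperm (a b : 'I_n) p : ev (tperm a b) p = swapn a b p.
Proof.
have [pn|np] := ltnP p n; last first.
  rewrite ev_out // /swapn; have := ltn_ord a; have := ltn_ord b.
  by case: eqP => [|_]; [lia | case: eqP => //; lia].
rewrite -[p]/(val (Ordinal pn)) evE permE /= /swapn -!val_eqE /=.
by case: eqP => // _; case: eqP.
Qed.

Lemma ev_simple (k : 'I_n.-1) p : ev (simple_transp k) p = swapn k k.+1 p.
Proof. exact: ev_tperm. Qed.

Lemma ev_ext u w : (forall p, p < n -> ev u p = ev w p) -> u = w.
Proof.
move=> E; apply/permP => i; apply: val_inj; have := E i (ltn_ord i).
by rewrite !evE. Qed.

Lemma perm_length_word ws : perm_length (simple_word ws) <= size ws.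
Proof.
rewrite /perm_length; case: ex_minnP => k _; apply.
by apply/existsP; exists (in_tuple ws).
Qed.

Lemma reduced_word u : exists2 ws, simple_word ws = u & size ws = perm_length u.
Proof.
rewrite /perm_length; case: ex_minnP => k /existsP[ws /eqP <-] _.
by exists ws; rewrite ?size_tuple.
Qed.

Lemma simple_word_cons k ws :
  simple_word (k :: ws) = perm_comp (simple_transp k) (simple_word ws).
Proof. by rewrite /simple_word big_cons. Qed.

Lemma perm_length_comp_word u ws :
  perm_length (perm_comp u (simple_word ws)) <= perm_length u + size ws.
Proof.
have [us <- <-] := reduced_word u.
by rewrite -simple_word_cat -size_cat perm_length_word.
Qed.

Lemma simple_word_rev ws : simple_word (rev ws) = (simple_word ws)^-1%g.
Proof.
elim: ws => [|k ws IH]; first by rewrite /simple_word !big_nil invg1.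
rewrite rev_cons -cats1 simple_word_cat IH (simple_word_cons k ws).
rewrite /perm_comp invMg.
by rewrite /simple_word big_seq1 /simple_transp tpermV.
Qed.

Lemma perm_length_inv u : perm_length u^-1 = perm_length u.
Proof.
have le z : perm_length z^-1 <= perm_length z.
  have [ws <- <-] := reduced_word z.
  by rewrite -simple_word_rev -[X in _ <= X]size_rev perm_length_word.
by apply/eqP; rewrite eqn_leq le -[X in perm_length X <= _]invgK le.
Qed.

(** Follow the pair (a, b) through the word from the right. Its order gets
    reversed, which only a letter s_k meeting it as (k, k+1) can do; deleting this
    letter amounts to exchanging a and b first. *)
Lemma exchange ws (a b : 'I_n) : a < b ->
  simple_word ws b < simple_word ws a ->
  exists2 ws', size ws' < size ws &
    simple_word ws' = perm_comp (simple_word ws) (tperm a b).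
Proof.
move=> ab; elim: ws => [|k ws IH].
  by rewrite /simple_word big_nil !perm1; lia.
rewrite simple_word_cons; set z := simple_word ws => lt.
have [zlt|zgt|/val_inj/perm_inj Eab] := ltngtP (z a) (z b); last first.
- by rewrite Eab ltnn in ab.
- have [ws' sz E] := IH zgt; exists (k :: ws') => //.
  by rewrite simple_word_cons E perm_compA.
exists ws => //.
have [Ea Eb] : z a = k :> nat /\ z b = k.+1 :> nat.
  move: lt; rewrite !perm_compE -!evE !ev_simple !evE /swapn.
  repeat (case: ifP => [/eqP ?|/eqP ?]); lia.
apply: ev_ext => p _; rewrite !ev_comp ev_simple ev_tperm.
have [->|pa] := eqVneq p (a : nat); first by rewrite swapnL !evE Eb swapnR.
have [->|pb] := eqVneq p (b : nat); first by rewrite swapnR !evE Ea swapnL.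
by rewrite (swapnD pa pb) swapnD // -?Eb -?Ea -evE (inj_eq (@ev_inj _)).
Qed.

Lemma ltn_length_tperm u (a b : 'I_n) : a < b -> u a < u b ->
  perm_length u < perm_length (perm_comp u (tperm a b)).
Proof.
move=> ab uab; have [ws E <-] := reduced_word (perm_comp u (tperm a b)).
have [|ws' sz E'] := @exchange ws a b ab.
  by rewrite E !perm_compE tpermL tpermR.
apply: leq_ltn_trans sz; suff <- : simple_word ws' = u by apply: perm_length_word.
by rewrite E' E -perm_compA /perm_comp tperm2 mul1g.
Qed.

Lemma bruhat_stepP u w : reflect
  (exists2 ab : 'I_n * 'I_n, ab.1 < ab.2 /\ u ab.1 < u ab.2 &
     w = perm_comp u (tperm ab.1 ab.2)) (bruhat_step u w).
Proof.
apply: (iffP idP) => [/existsP[a /existsP[b /andP[/eqP-> lt]]]|].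
  wlog ab : a b lt / a < b => [H|].
    have [ab|ba|/val_inj Eab] := ltngtP a b; first exact: H.
      by rewrite tpermC in lt *; apply: H.
    by rewrite Eab tperm1 perm_compp1 ltnn in lt.
  exists (a, b) => //=; split=> //.
  have [//|uba|/val_inj/perm_inj Eab] := ltngtP (u a) (u b); last first.
    by rewrite Eab ltnn in ab.
  have := @ltn_length_tperm (perm_comp u (tperm a b)) a b ab.
  rewrite !perm_compE tpermL tpermR -perm_compA /perm_comp tperm2 mul1g.
  by move=> /(_ uba) /(ltn_trans lt); rewrite ltnn.
move=> [[a b] /= [ab uab] ->]; apply/existsP; exists a; apply/existsP; exists b.
by rewrite eqxx ltn_length_tperm.
Qed.

(** The easy half of the tableau criterion: a step of Bruhat order moves a larger
    value to the left. *)
Lemma bruhat_cnt u w x s :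
  bruhat u w -> cnt (ev u) 0 x s <= cnt (ev w) 0 x s.
Proof.
move=> /connectP[c + ->]; elim: c u => //= z c IH u /andP[/bruhat_stepP uz].
move=> /IH; apply: leq_trans; case: uz => -[a b] /= [ab uab] ->.
rewrite (@eq_cnt (ev (perm_comp u _)) (ev u \o swapn a b)); last first.
  by move=> q _; rewrite ev_comp ev_tperm.
have := cnt_swap (ev u) x s (leq0n a) ab; rewrite !evE.
have : (s <= u a) <= (s <= u b).
  by case: (leqP s (u a)) => // sa; rewrite (leq_trans sa (ltnW uab)).
move: (nat_of_bool (s <= u a)) (nat_of_bool (s <= u b)) => A B.
by case: (_ && _); rewrite /= ?mul1n ?mul0n; lia.
Qed.

Lemma bruhat_inv u w : bruhat u w -> bruhat u^-1%g w^-1%g.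
Proof.
move=> /connectP[c + ->]; elim: c u => [|z c IH] u //=; first by rewrite /bruhat connect0.
move=> /andP[/existsP[a /existsP[b /andP[/eqP Ez lt]]] /IH].
apply: connect_trans; apply: connect1; apply/existsP; exists (u a).
apply/existsP; exists (u b); rewrite !perm_length_inv lt andbT Ez /perm_comp.
by rewrite invMg tpermV -tpermJ conjgE !mulgA mulgK.
Qed.

End Perm.

(** * The Bruhat interval is cut out by the rank counts *)

(** Complementing values turns counts above s into counts below. *)
Lemma cnt_rev N g a b s : (forall q, a <= q < b -> g q < N) ->
  cnt (fun q => N.-1 - g q) a b s + cnt g a b (N - s) = b - a.
Proof.
move=> gN; rewrite -[RHS]muln1 -sum_nat_const_nat /cnt -big_split.
by apply: eq_big_nat => q /gN /= ?; case: leqP; case: leqP; lia.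
Qed.

Record block := Block { blo : nat; bhi : nat; bfwd : bool }.

Section Interval.

Variables (n m : nat) (v w : 'S_n) (lnk : 'I_m -> nat) (blk : 'I_m -> block).
Implicit Types (y z : 'S_n) (i : 'I_m).

Local Notation L i := (blo (blk i)).
Local Notation H i := (bhi (blk i)).
Local Notation fwd i := (bfwd (blk i)).

(** Backward blocks are read with complemented values and with w in the role of
    the base permutation, which makes them forward blocks. *)
Definition key i y p : nat := if fwd i then ev y p else n.-1 - ev y p.

Definition base i : 'S_n := if fwd i then v else w.

Definition lab y i : bool := label (L i) (key i (base i)) (key i y) (lnk i).

Definition in_interval y : Prop :=
  (forall i, admissible (L i) (H i) (key i (base i)) (key i y)) /\
  (forall p, (forall i, ~~ (L i <= p <= H i)) -> ev y p = ev v p).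

(** What remains of a proper product of runs: [lnk i] is the position to the right
    of the i-th letter, hence never the first position of its block, and the rank
    counts of v and w agree at every prefix that no letter crosses. *)
Record blocks_spec : Prop := BlocksSpec {
  lnk_inj : injective lnk;
  lnk_blk : forall i, L i < lnk i <= H i;
  bhi_lt : forall i, H i < n;
  blk_lnk : forall i q, L i < q <= H i ->
    exists2 i', lnk i' = q & blk i' = blk i;
  blk_sep : forall i i', [\/ blk i = blk i', H i < L i' | H i' < L i];
  fwd_spec : forall i, fwd i ->
    [/\ forall p, L i <= p < H i -> ev w p = ev v p.+1, ev w (H i) = ev v (L i)
      & forall p, L i < p <= H i -> ev v (L i) < ev v p];
  bwd_spec : forall i, ~~ fwd i ->
    [/\ forall p, L i <= p < H i -> ev v p = ev w p.+1, ev v (H i) = ev w (L i)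
      & forall p, L i < p <= H i -> ev w p < ev w (L i)];
  cnt_unlinked : forall x s, (forall i, x != lnk i) ->
    cnt (ev w) 0 x s = cnt (ev v) 0 x s }.

Hypothesis B : blocks_spec.

Lemma key_inj i y p q : p < n -> q < n -> key i y p = key i y q -> p = q.
Proof.
rewrite /key => pn qn; case: (fwd i) => [/ev_inj //|E].
apply: (@ev_inj _ y); move: pn qn; rewrite -(ev_lt y p) -(ev_lt y q); lia.
Qed.

Lemma base_inj i p q : L i <= p <= H i -> L i <= q <= H i ->
  key i (base i) p = key i (base i) q -> p = q.
Proof. by move=> ? ?; apply: key_inj; have := bhi_lt B i; lia. Qed.

Lemma base_min i p : L i < p <= H i ->
  key i (base i) (L i) < key i (base i) p.
Proof.
move=> pLH; have := bhi_lt B i; rewrite /key /base; case F: (fwd i) => Hn.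
  by have [_ _] := fwd_spec B F; apply.
have [_ _ /(_ _ pLH)] := bwd_spec B (negbT F).
have : ev w (L i) < n by rewrite ev_lt; lia.
lia.
Qed.

Lemma other_shift i y : y = (if fwd i then w else v) ->
  (forall p, L i <= p < H i -> key i y p = key i (base i) p.+1) /\
  key i y (H i) = key i (base i) (L i).
Proof.
move=> ->; rewrite /key /base; case F: (fwd i).
  by have [E1 E2 _] := fwd_spec B F; split=> [p /E1|].
by have [E1 E2 _] := bwd_spec B (negbT F); split=> [p /E1 ->|]; rewrite ?E2.
Qed.

Lemma blo_le i : L i <= H i. Proof. by have := lnk_blk B i; lia. Qed.

Lemma admissible_ends i :
  admissible (L i) (H i) (key i (base i)) (key i v) /\
  admissible (L i) (H i) (key i (base i)) (key i w).
Proof.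
have base_adm := admissible_refl (L i) (H i) (key i (base i)).
have rot y : y = (if fwd i then w else v) ->
    admissible (L i) (H i) (key i (base i)) (key i y).
  move=> /other_shift[E1 E2].
  exact: (admissible_rotation (@base_min i) E1 E2 (blo_le i)).
by move: base_adm rot; rewrite /base; case: (fwd i) => b r; split=> //; apply: r.
Qed.

Lemma lab_ends i : lab v i = ~~ fwd i /\ lab w i = fwd i.
Proof.
have rot y : y = (if fwd i then w else v) -> lab y i.
  move=> /other_shift[E1 E2].
  exact: (label_rotation (@base_min i) E1 E2 (lnk_blk B i)).
have refl : lab (base i) i = false by apply: label_refl.
by move: rot refl; rewrite /base; case: (fwd i) => r ->; split=> //; rewrite r.
Qed.

Lemma off_block p : (forall i, ~~ (L i <= p <= H i)) ->
  forall i, p != lnk i /\ p.+1 != lnk i.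
Proof. by move=> off i; have := off i; have := lnk_blk B i; lia. Qed.

Lemma ev_cnt y z p : (forall s, cnt (ev y) 0 p s = cnt (ev z) 0 p s) ->
  (forall s, cnt (ev y) 0 p.+1 s = cnt (ev z) 0 p.+1 s) -> ev y p = ev z p.
Proof.
move=> E1 E2; have E s : (s <= ev y p) = (s <= ev z p).
  have := E2 s; rewrite !cntS // E1 => /addnI.
  by case: (s <= ev y p); case: (s <= ev z p).
by apply/eqP; rewrite eqn_leq -E leqnn E leqnn.
Qed.

Lemma in_interval_ends : in_interval v /\ in_interval w.
Proof.
split; split=> [i|p off] //; try by have [] := admissible_ends i.
by apply: ev_cnt => s; apply: cnt_unlinked => // i; have [] := off_block off i.
Qed.

Lemma block_ends i i' : (L i != lnk i') /\ ((H i).+1 != lnk i').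
Proof.
have := blo_le i; have := lnk_blk B i'; case: (blk_sep B i i') => [->||]; lia.
Qed.

(** At the two ends of a block the counts of v and w agree, so those of y are
    forced; subtracting them localizes the bounds to the block. On a forward block
    the counts of w are shifted counts of v up to the entry that wrapped around,
    and on a backward block the same holds after complementation. *)
Lemma bruhat_in_interval y : bruhat v y -> bruhat y w -> in_interval y.
Proof.
move=> vy yw.
have sand x s : cnt (ev v) 0 x s <= cnt (ev y) 0 x s <= cnt (ev w) 0 x s.
  by rewrite !bruhat_cnt.
have unl x : (forall i, x != lnk i) -> forall s,
    cnt (ev y) 0 x s = cnt (ev v) 0 x s.
  by move=> off s; apply/eqP; rewrite eqn_leq -{1}(cnt_unlinked B s off) andbC.
split; last first.
  by move=> p off; apply: ev_cnt => s; apply: unl => i; have [] := off_block off i.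
move=> i; have Hn := bhi_lt B i; have lh := blo_le i.
have EL s : cnt (ev y) 0 (L i) s = cnt (ev v) 0 (L i) s.
  by apply: unl => i'; have [] := block_ends i i'.
have ELw s : cnt (ev w) 0 (L i) s = cnt (ev v) 0 (L i) s.
  by apply: cnt_unlinked => // i'; have [] := block_ends i i'.
have EH s : cnt (ev y) (L i) (H i).+1 s = cnt (ev v) (L i) (H i).+1 s.
  have lh' := leqW lh.
  have : cnt (ev y) 0 (H i).+1 s = cnt (ev v) 0 (H i).+1 s.
    by apply: unl => i'; have [] := block_ends i i'.
  by rewrite !(cnt_cat _ s (leq0n _) lh') EL => /addnI.
have EHw s : cnt (ev w) (L i) (H i).+1 s = cnt (ev v) (L i) (H i).+1 s.
  have lh' := leqW lh.
  have : cnt (ev w) 0 (H i).+1 s = cnt (ev v) 0 (H i).+1 s.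
    by apply: cnt_unlinked => // i'; have [] := block_ends i i'.
  by rewrite !(cnt_cat _ s (leq0n _) lh') ELw => /addnI.
have sandL x s : L i <= x ->
    cnt (ev v) (L i) x s <= cnt (ev y) (L i) x s /\
    cnt (ev y) (L i) x s <= cnt (ev w) (L i) x s.
  move=> Lx; apply/andP; have := sand x s.
  by rewrite !(cnt_cat _ s (leq0n _) Lx) EL ELw !leq_add2l.
have rev z x s : L i <= x -> x <= n ->
    cnt (fun q => n.-1 - ev z q) (L i) x s = (x - L i) - cnt (ev z) (L i) x (n - s).
  move=> Lx xn; rewrite -(@cnt_rev n (ev z) (L i) x s) ?addnK // => q ?.
  by rewrite ev_lt; lia.
rewrite /key /base; case F: (fwd i).
  have [Ew _ _] := fwd_spec B F; split=> [x s ?|x s ?|s]; last exact: EH.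
    have [|le _] := sandL x s; [lia | exact: le].
  have Lx : L i <= x by lia.
  have [_ /leq_trans] := sandL x s Lx; apply.
  rewrite (@eq_cnt _ (ev v \o succn)); last by move=> q ?; rewrite /= Ew //; lia.
  by rewrite [X in _ <= X]cnt_recl; [rewrite /cnt big_add1 leq_addl | lia].
have [Ev _ _] := bwd_spec B (negbT F); split=> [x s ?|x s ?|s].
- rewrite !rev; [|lia|lia|lia|lia].
  by have [|_ le] := sandL x (n - s); lia.
- rewrite !rev; [|lia|lia|lia|lia].
  have [|+ _] := sandL x (n - s); first by lia.
  suff : cnt (ev w) (L i) x.+1 (n - s) <= (cnt (ev v) (L i) x (n - s)).+1 by lia.
  rewrite cnt_recl; last by lia.
  rewrite -[X in _ <= X]add1n leq_add ?leq_b1 // (@eq_cnt (ev v) (ev w \o succn)).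
    by rewrite /cnt big_add1.
  by move=> q ?; rewrite /= Ev //; lia.
by rewrite !rev ?EH ?EHw //; lia.
Qed.

Lemma eq_interval y z : in_interval y -> in_interval z -> lab y =1 lab z ->
  y = z.
Proof.
move=> [ya yo] [za zo] E; apply: ev_ext => p pn.
have [/existsP[i pi]|no] := boolP [exists i, L i <= p <= H i]; last first.
  by rewrite yo ?zo // => i; move/existsPn: no; apply.
have : key i y p = key i z p.
  apply: (label_inj (@base_inj i) (@base_min i) (ya i) (za i)) => // j /(blk_lnk B).
  by move=> [i' <- Ei']; have := E i'; rewrite /lab /base /key Ei'.
rewrite /key; case: (fwd i) => //; have := ev_lt y p; have := ev_lt z p; lia.
Qed.

(** The last clause orients the flip: it goes down in Bruhat order exactly when the
    label agrees with that of w ([lab_ends]). *)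
Lemma interval_flip y i : in_interval y -> exists a b : 'I_n,
  let y' := perm_comp y (tperm a b) in
  [/\ a < b, in_interval y', forall i', lab y' i' = lab y i' (+) (i' == i)
    & if lab y i == fwd i then y b < y a else y a < y b].
Proof.
move=> [ya yo]; have Hn := bhi_lt B i.
have [a [b [La abH lt adm' lab']]] :=
  flip_spec (@base_inj i) (@base_min i) (ya i) (lnk_blk B i).
have an : a < n by lia. have bn : b < n by lia.
exists (Ordinal an), (Ordinal bn) => y'.
have key' i' : key i' y' =1 key i' y \o swapn a b.
  by move=> p; rewrite /key /= ev_comp ev_tperm.
have same i' : blk i' = blk i \/ (H i < L i' \/ H i' < L i).
  by case: (blk_sep B i i') => [->|?|?]; [left | right; left | right; right].
have far i' p : H i < L i' \/ H i' < L i ->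
    L i' <= p <= H i' -> key i' y p = key i' y' p.
  by move=> D pb; rewrite key' /= swapnD //; apply/eqP; lia.
have near i' : blk i' = blk i -> key i' y' =1 key i y \o swapn a b.
  by move=> E p; rewrite key' /key E.
have base' i' : blk i' = blk i -> key i' (base i') = key i (base i).
  by move=> E; rewrite /key /base E.
have ab : a < b by lia.
split=> //.
- split=> [i'|p off].
    have [E|D] := same i'.
    + rewrite base' // E; apply: eq_admissible adm' => p _.
      by rewrite near.
    by apply: eq_admissible (ya i') => p; apply: far.
  rewrite -yo // ev_comp ev_tperm swapnD //.
    by apply: contraNneq (off i) => -> /=; lia.
  by apply: contraNneq (off i) => -> /=; lia.
- move=> i'; have [E|D] := same i'.
  + rewrite /lab base' // E.
    have -> : (i' == i) = (lnk i' == lnk i) by rewrite (inj_eq (lnk_inj B)).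
    have jlh : L i < lnk i' <= H i by rewrite -E; apply: lnk_blk.
    rewrite (@eq_label _ _ _ (key i y \o swapn a b)) => [|q _]; last exact: near.
    by rewrite lab' // /key E.
  have -> : (i' == i) = false by apply/eqP => E; rewrite E in D; lia.
  rewrite addbF; apply/esym/eq_label => q ?; apply: far => //.
  by have := lnk_blk B i'; lia.
move: lt; rewrite -/(lab y i) /key -!(evE y) /=.
have := ev_lt y a; have := ev_lt y b.
by case: (lab y i); case: (fwd i) => /=; lia.
Qed.

Lemma bruhat_step_tperm y (a b : 'I_n) : a < b -> y a < y b ->
  bruhat_step y (perm_comp y (tperm a b)).
Proof. by move=> ab yab; apply/bruhat_stepP; exists (a, b). Qed.

(** Flip, one after the other, the labels in which y differs from v; every flip
    goes down, and [eq_interval] identifies the element where this stops. *)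
Lemma interval_bottom y : in_interval y -> bruhat v y.
Proof.
have [N] := ubnP (perm_length y); elim: N y => // N IH y lty Vy.
have [Vv _] := in_interval_ends.
have [/existsP[i /eqP li]|no] := boolP [exists i, lab y i == fwd i]; last first.
  suff -> : y = v by rewrite /bruhat connect0.
  apply: eq_interval => // i; have [-> _] := lab_ends i.
  by move/existsPn: no => /(_ i); case: (lab y i); case: (fwd i).
have [a [b [ab Vy' _]]] := interval_flip i Vy; rewrite li eqxx => yba.
set y' := perm_comp y _ in Vy'.
have yE : y = perm_comp y' (tperm a b).
  by rewrite /y' -perm_compA /perm_comp tperm2 mul1g.
have st : bruhat_step y' y.
  by rewrite [X in bruhat_step _ X]yE; apply: bruhat_step_tperm;
    rewrite // /y' !perm_compE tpermL tpermR.
apply: connect_trans (connect1 st); apply: IH => //.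
rewrite ltnS in lty; apply: leq_trans lty; rewrite [X in _ < perm_length X]yE.
by apply: ltn_length_tperm; rewrite // /y' !perm_compE tpermL tpermR.
Qed.

Lemma interval_top y : in_interval y -> bruhat y w.
Proof.
pose M := \max_(z : 'S_n) perm_length z.
have leM (z : 'S_n) : perm_length z <= M by apply: leq_bigmax.
have [N] := ubnP (M - perm_length y); elim: N y => // N IH y lty Vy.
have [_ Vw] := in_interval_ends.
have [/existsP[i /negbTE li]|no] := boolP [exists i, lab y i != fwd i]; last first.
  suff -> : y = w by rewrite /bruhat connect0.
  apply: eq_interval => // i; have [_ ->] := lab_ends i.
  by move/existsPn: no => /(_ i); rewrite negbK => /eqP.
have [a [b [ab Vy' _]]] := interval_flip i Vy; rewrite li => yab.
apply: connect_trans (connect1 (bruhat_step_tperm ab yab)) _; apply: IH => //.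
by have := ltn_length_tperm ab yab; have := leM (perm_comp y (tperm a b)); lia.
Qed.

Lemma in_intervalP y : in_interval y <-> bruhat v y /\ bruhat y w.
Proof.
split=> [Vy|[vy yw]]; last exact: bruhat_in_interval.
by split; [apply: interval_bottom | apply: interval_top].
Qed.

End Interval.

(** * Proper products rotate disjoint blocks *)

Section Words.

Variable n : nat.
Implicit Types (ws : seq 'I_n.-1) (p x : nat) (k : 'I_n.-1).

Lemma word_fix ws p :
  (forall k, k \in ws -> (k != p :> nat) /\ (k.+1 != p)) ->
  ev (simple_word ws) p = p.
Proof.
elim: ws => [|k ws IH] ok; first by rewrite /simple_word big_nil ev1.
rewrite simple_word_cons ev_comp IH => [|k' k'ws].
  by have [kp kp'] := ok k (mem_head _ _); rewrite ev_simple swapnD // eq_sym.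
by apply: ok; rewrite inE k'ws orbT.
Qed.

Lemma word_prefix ws x p : (forall k, k \in ws -> k.+1 != x) ->
  (ev (simple_word ws) p < x) = (p < x).
Proof.
elim: ws => [|k ws IH] ok; first by rewrite /simple_word big_nil ev1.
rewrite simple_word_cons ev_comp -IH => [|k' k'ws]; last first.
  by apply: ok; rewrite inE k'ws orbT.
rewrite ev_simple /swapn; have := ok k (mem_head _ _).
by case: ifP => [/eqP ?|_]; [|case: ifP => [/eqP ?|//]]; lia.
Qed.

(** Only the letter k moves entries across the end of the prefix of length k + 1,
    and in a word without repetition it does so once, so nothing can undo it. *)
Lemma word_move ws k : uniq ws -> k \in ws ->
  exists2 p, p <= k & k < ev (simple_word ws) p.
Proof.
move=> + /splitPr kws; case: kws => a b.
rewrite cat_uniq /= negb_or => /andP[ua /and3P[/andP[ka _] kb ub]].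
have off (c : seq 'I_n.-1) : k \notin c -> forall k', k' \in c -> k'.+1 != k.+1.
  by move=> kc k' k'c; rewrite eqSS (inj_eq val_inj); apply: contraNneq kc => <-.
exists (ev (simple_word b)^-1 k).
  by rewrite -ltnS -(word_prefix _ (off b kb)) evKV.
rewrite simple_word_cat simple_word_cons !ev_comp evKV ev_simple swapnL.
by rewrite ltnNge -ltnS word_prefix ?ltnn //; apply: off.
Qed.

(** The letters of a word without repetition are determined by the permutation:
    they mark the ends of the prefixes that it does not preserve. *)
Lemma mem_word ws ws' : uniq ws -> uniq ws' ->
  simple_word ws = simple_word ws' -> perm_eq ws ws'.
Proof.
suff sub (a b : seq 'I_n.-1) : uniq a ->
    simple_word a = simple_word b -> {subset a <= b}.
  move=> u u' E; apply: uniq_perm => // k; apply/idP/idP; exact: sub.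
move=> ua E k /(word_move ua)[p pk]; rewrite E; apply: contraTT => kb.
rewrite -leqNgt -ltnS word_prefix ?ltnS // => k' k'b.
by rewrite eqSS (inj_eq val_inj); apply: contraNneq kb => <-.
Qed.

Lemma cnt_word v ws x s : (forall k, k \in ws -> k.+1 != x) ->
  cnt (ev (perm_comp v (simple_word ws))) 0 x s = cnt (ev v) 0 x s.
Proof.
move=> ok; set c := simple_word ws; rewrite /cnt.
have pe: perm_eq (map (ev c) (index_iota 0 x)) (index_iota 0 x).
  have u : uniq (map (ev c) (index_iota 0 x)).
    by rewrite (map_inj_uniq (@ev_inj _ c)) iota_uniq.
  have sub : {subset map (ev c) (index_iota 0 x) <= index_iota 0 x}.
    move=> _ /mapP[q + ->]; rewrite !mem_index_iota /=.
    by rewrite word_prefix.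
  apply: uniq_perm => //; first exact: iota_uniq.
  by have [] := uniq_min_size u sub; rewrite ?size_map.
rewrite -[RHS](perm_big _ pe) big_map; apply: eq_bigr => q _.
by rewrite ev_comp.
Qed.

(** If the length grows by the size of the word, every letter must raise it. *)
Lemma length_prefix u (a b : seq 'I_n.-1) k :
  perm_length (perm_comp u (simple_word (a ++ k :: b))) =
    perm_length u + size (a ++ k :: b) ->
  ev (perm_comp u (simple_word a)) k < ev (perm_comp u (simple_word a)) k.+1.
Proof.
set ua := perm_comp u (simple_word a) => E.
have : perm_length ua < perm_length (perm_comp ua (simple_transp k)).
  have := perm_length_comp_word (perm_comp ua (simple_transp k)) b.
  have := perm_length_comp_word u a; rewrite -/ua.
  have <- : perm_comp u (simple_word (a ++ k :: b)) =
      perm_comp (perm_comp ua (simple_transp k)) (simple_word b).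
    by rewrite simple_word_cat simple_word_cons !perm_compA.
  by rewrite E size_cat /=; lia.
move=> lt.
pose x := Ordinal (simple_lo_subproof k); pose y := Ordinal (simple_hi_subproof k).
rewrite -[val k]/(val x) -[k.+1]/(val y) !evE.
case: (ltngtP (ua x) (ua y)) => // [yx|/val_inj/perm_inj /(congr1 val) /=]; last by lia.
have := @ltn_length_tperm _ (perm_comp ua (simple_transp k)) x y.
have sE : simple_transp k = tperm x y by [].
rewrite !perm_compE sE tpermL tpermR -perm_compA.
have -> : perm_comp (tperm x y) (tperm x y) = 1%g by exact: tperm2.
rewrite perm_compp1 -sE.
rewrite /ua !perm_compE in yx.
by move=> /(_ (ltnSn k) yx); rewrite ltnNge (ltnW lt).
Qed.

Lemma ascending_word ws l d p : map val ws = iota l d ->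
  ev (simple_word ws) p =
    if l <= p < l + d then p.+1 else if p == l + d then l else p.
Proof.
elim: ws l d => [|k ws IH] l [|d] //=.
  move=> _; rewrite /simple_word big_nil ev1 addn0.
  by case: ifP; [lia | case: eqP => // ->].
case=> kl E; rewrite simple_word_cons ev_comp ev_simple (IH _ _ E) kl /swapn.
by have [H1|H1] := boolP (l < p < l.+1 + d);
  [|have [H2|H2] := boolP (p == l.+1 + d)]; repeat (case: ifP => ?); lia.
Qed.

End Words.

Section Runs.

Variable n : nat.
Implicit Types (e f : 'I_n.-1 * 'I_n.-1) (es : seq ('I_n.-1 * 'I_n.-1)).
Implicit Types (k : 'I_n.-1) (v w : 'S_n).

(** A run on the letters from p to q moves the positions from p to q + 1. *)
Definition run_block e : block :=
  Block (minn e.1 e.2) (maxn e.1 e.2).+1 (e.1 <= e.2).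

Local Notation lo e := (blo (run_block e)).
Local Notation hi e := (bhi (run_block e)).

Definition run_word e : seq 'I_n.-1 :=
  if e.1 <= e.2 then seg e else rev (seg e).

Definition runs_word es : seq 'I_n.-1 := flatten (map run_word es).

Lemma runs_wordE es :
  \big[@perm_comp n/1%g]_(e <- es) mono_run e = simple_word (runs_word es).
Proof.
elim: es => [|e es IH]; first by rewrite /simple_word !big_nil.
by rewrite big_cons IH /runs_word /= simple_word_cat.
Qed.

Lemma run_bounds e : [/\ lo e < hi e & hi e < n].
Proof. by have := ltn_ord e.1; have := ltn_ord e.2; rewrite /run_block /=; lia. Qed.

Lemma mem_seg e k : (k \in seg e) = (lo e <= k < hi e).
Proof. by rewrite mem_filter mem_enum andbT /run_block /= ltnS. Qed.

Lemma mem_run_word e k : (k \in run_word e) = (lo e <= k < hi e).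
Proof. by rewrite -mem_seg /run_word; case: ifP; rewrite ?mem_rev. Qed.

Lemma mem_runs_word es k :
  reflect (exists2 e, e \in es & lo e <= k < hi e) (k \in runs_word es).
Proof.
apply: (iffP flatten_mapP) => -[e ees ke]; exists e => //.
  by rewrite mem_run_word in ke.
by rewrite mem_run_word.
Qed.

Lemma val_seg e : map val (seg e) = iota (lo e) (hi e - lo e).
Proof.
have [lh hn] := run_bounds e.
have -> : map val (seg e) = filter (fun q => lo e <= q < hi e) (iota 0 n.-1).
  by rewrite -val_enum_ord filter_map; congr map; apply: eq_filter.
apply: (irr_sorted_eq ltn_trans ltnn).
- exact: (sorted_filter ltn_trans _ (iota_ltn_sorted _ _)).
- exact: iota_ltn_sorted.
by move=> q; rewrite mem_filter !mem_iota; lia.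
Qed.

Lemma uniq_seg e : uniq (seg e).
Proof. by rewrite filter_uniq ?enum_uniq. Qed.

(** Disjoint and not adjacent: the blocks of positions, which are one longer than
    the intervals of letters, are still disjoint. *)
Definition apart e f : bool := (hi e < lo f) || (hi f < lo e).

Lemma seg_apart e f :
  [disjoint seg e & seg f] -> ~~ adjacent e f -> apart e f.
Proof.
move=> /disjointFr D; rewrite /adjacent /apart /run_block /= => A.
suff : (maxn e.1 e.2).+1 <= minn f.1 f.2 \/ (maxn f.1 f.2).+1 <= minn e.1 e.2.
  by move: A; lia.
pose ke := if e.1 <= e.2 then e.1 else e.2.
pose kf := if f.1 <= f.2 then f.1 else f.2.
have Ee : ke = minn e.1 e.2 :> nat by rewrite /ke /minn; case: ltngtP.
have Ef : kf = minn f.1 f.2 :> nat by rewrite /kf /minn; case: ltngtP.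
have De := D ke; have Df := D kf; move: De Df; rewrite !mem_seg Ee Ef /run_block /=.
by lia.
Qed.

Lemma runs_apart es : pairwise (fun e f => [disjoint seg e & seg f]) es ->
  pairwise (fun e f => ~~ adjacent e f) es -> pairwise apart es.
Proof.
elim: es => //= e es IH /andP[de des] /andP[ae aes]; rewrite IH // andbT.
apply/allP => f fes; apply: seg_apart; first exact: (allP de).
exact: (allP ae).
Qed.

Lemma runs_word_uniq es : pairwise apart es -> uniq (runs_word es).
Proof.
elim: es => //= e es IH /andP[ae aes]; rewrite /runs_word /= cat_uniq IH // andbT.
rewrite {1}/run_word (fun_if uniq) rev_uniq uniq_seg if_same /=.
apply/hasPn => k /mem_runs_word[f fes kf]; rewrite /= mem_run_word.
by have := allP ae f fes; rewrite /apart; lia.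
Qed.

Lemma apart_sym e f : apart e f = apart f e.
Proof. exact: orbC. Qed.

Lemma apart_mem es e f : pairwise apart es -> e \in es -> f \in es ->
  e = f \/ apart e f.
Proof.
elim: es => //= g es IH /andP[/allP ag aes]; rewrite !inE.
move=> /predU1P[->|ees] /predU1P[->|fes]; [by left | | | exact: IH].
  by right; apply: ag.
by right; rewrite apart_sym; apply: ag.
Qed.

Lemma runs_fix es p : (forall e, e \in es -> hi e < p \/ p < lo e) ->
  ev (simple_word (runs_word es)) p = p.
Proof.
move=> far; apply: word_fix => k /mem_runs_word[e ees ke].
by have := far e ees; lia.
Qed.

Lemma run_rotation e p :
  ev (simple_word (seg e)) p =
    if lo e <= p < hi e then p.+1 else if p == hi e then lo e else p.
Proof.
have [lh _] := run_bounds e.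
by rewrite (ascending_word _ (val_seg e)) subnKC // ltnW.
Qed.

Lemma seg_split e q : lo e <= q < hi e ->
  exists a k b, [/\ seg e = a ++ k :: b, k = q :> nat,
    map val a = iota (lo e) (q - lo e)
    & map val b = iota q.+1 (hi e - q.+1)].
Proof.
move=> qe; have szs : size (seg e) = hi e - lo e.
  by rewrite -(size_map val) val_seg size_iota.
have rs : q - lo e < size (seg e) by rewrite szs; lia.
exists (take (q - lo e) (seg e)), (nth e.1 (seg e) (q - lo e)).
exists (drop (q - lo e).+1 (seg e)); rewrite -drop_nth // cat_take_drop; split=> //.
- by rewrite -(nth_map _ 0) // val_seg nth_iota -?szs // subnKC //; lia.
- by rewrite map_take val_seg take_iota; congr iota; lia.
by rewrite map_drop val_seg drop_iota; congr iota; lia.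
Qed.

Section Product.

Variables (v w : 'S_n) (es : seq ('I_n.-1 * 'I_n.-1)).
Hypothesis es_apart : pairwise apart es.
Hypothesis wE : w = perm_comp v (simple_word (runs_word es)).
Hypothesis w_length : perm_length w = perm_length v + size (runs_word es).

(** The other runs do not touch the block of e, so the product acts on it as the
    single run e. *)
Lemma product_split e : e \in es -> exists a b,
  [/\ runs_word es = a ++ run_word e ++ b,
      forall p, lo e <= p <= hi e -> ev (simple_word a) p = p
    & forall p, lo e <= p <= hi e -> ev (simple_word b) p = p].
Proof.
move=> ees; move: es_apart; case/splitPr: ees => es1 es2.
rewrite pairwise_cat pairwise_cons => /and3P[/allrelP far _ /andP[/allP far2 _]].
exists (runs_word es1), (runs_word es2); split.
- by rewrite /runs_word map_cat flatten_cat.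
- move=> p pe; apply: runs_fix => f fes;
  have ap : apart f e by apply: far; rewrite ?mem_head.
  by case/orP: ap => ap; [left | right]; lia.
move=> p pe; apply: runs_fix => f fes; have ap : apart e f by exact: far2.
by case/orP: ap => ap; [right | left]; lia.
Qed.

(** Each letter of the run carries the first entry of the block one step to the
    right, past an entry that must be larger because the length increases. *)
Lemma forward_run e : e \in es -> e.1 <= e.2 ->
  [/\ forall p, lo e <= p < hi e -> ev w p = ev v p.+1,
      ev w (hi e) = ev v (lo e)
    & forall p, lo e < p <= hi e -> ev v (lo e) < ev v p].
Proof.
move=> ees fe; have [a [b [Wab fa fb]]] := product_split ees.
have [lh hn] := run_bounds e.
rewrite /run_word fe in Wab.
have wp p : lo e <= p <= hi e ->
    ev w p = ev v (if p < hi e then p.+1 else lo e).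
  move=> pe; rewrite wE Wab !simple_word_cat !ev_comp fb // run_rotation.
  by repeat case: ifP => ?; rewrite fa //; lia.
split=> [p pe||p pe].
- by rewrite wp; [case: ifP => //; lia | lia].
- by rewrite wp ?ltnn // leqnn ltnW.
have qe : lo e <= p.-1 < hi e by lia.
have [c [k [d [E kq cE _]]]] := seg_split qe.
have := @length_prefix n v (a ++ c) (d ++ b) k.
rewrite -catA -cat_cons (catA c) -E -Wab -wE => /(_ w_length).
rewrite simple_word_cat !ev_comp !(ascending_word _ cE) kq.
rewrite subnKC; last by lia.
rewrite ltnn andbF eqxx; have -> : (lo e <= p.-1.+1 < p.-1) = false by lia.
by case: eqP => [|_]; rewrite ?fa ?prednK //; lia.
Qed.

Lemma backward_run e : e \in es -> ~~ (e.1 <= e.2) ->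
  [/\ forall p, lo e <= p < hi e -> ev v p = ev w p.+1,
      ev v (hi e) = ev w (lo e)
    & forall p, lo e < p <= hi e -> ev w p < ev w (lo e)].
Proof.
move=> ees fe; have [a [b [Wab fa fb]]] := product_split ees.
have [lh hn] := run_bounds e.
rewrite /run_word (negbTE fe) in Wab.
have wE' p q : lo e <= p <= hi e -> lo e <= q <= hi e ->
    ev (simple_word (seg e)) p = q -> ev w q = ev v p.
  move=> pe qe pq; rewrite wE Wab !simple_word_cat !ev_comp fb //.
  by rewrite simple_word_rev -pq evK fa.
have wS p : lo e <= p < hi e -> ev w p.+1 = ev v p.
  by move=> pe; apply: wE'; rewrite ?run_rotation ?pe //; lia.
have wlo : ev w (lo e) = ev v (hi e).
  by apply: wE'; rewrite ?run_rotation ?ltnn ?andbF ?eqxx //; lia.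
split=> [p pe||p pe]; [by rewrite wS | by rewrite wlo |].
have qe : lo e <= p.-1 < hi e by lia.
rewrite wlo -(@prednK p) ?wS //; last by lia.
have [c [k [d [E kq _ dE]]]] := seg_split qe.
have := @length_prefix n v (a ++ rev d) (rev c ++ b) k.
rewrite -catA -cat_cons (catA (rev d)) -cat_rcons -rev_cons -rev_cat -E -Wab.
rewrite -wE => /(_ w_length).
rewrite simple_word_cat !ev_comp simple_word_rev.
have -> : ev (simple_word d)^-1 k.+1 = hi e.
  apply: (canLR (evK _)); rewrite (ascending_word _ dE) kq subnKC; last by lia.
  by rewrite ltnn andbF eqxx.
have -> : ev (simple_word d)^-1 k = k.
  apply: (canLR (evK _)); rewrite (ascending_word _ dE) kq subnKC; last by lia.
  by rewrite ltnn; case: eqP => //; lia.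
by rewrite !fa ?kq //; lia.
Qed.

(** The passage from words to [blocks_spec]: afterwards only the shape of v and w
    on the blocks and their rank counts matter. *)
Lemma runs_blocks m (j : m.-tuple 'I_n.-1) : perm_eq j (runs_word es) ->
  exists blk, blocks_spec v w (fun i => (tnth j i).+1) blk.
Proof.
move=> jW; have uj : uniq j by rewrite (perm_uniq jW) runs_word_uniq.
have run i : exists e, (e \in es) && (lo e <= tnth j i < hi e).
  have : tnth j i \in runs_word es by rewrite -(perm_mem jW) mem_tnth.
  by case/mem_runs_word => e ees ke; exists e; rewrite ees.
pose r i := xchoose (run i).
have rP i : r i \in es /\ lo (r i) <= tnth j i < hi (r i).
  by have /andP := xchooseP (run i).
exists (fun i => run_block (r i)); split=> [i i'|i|i|i q|i i'|i|i|x s off].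
- case=> /val_inj E; apply: (tuple_uniqP _ uj) => //.
- by have [_] := rP i; lia.
- by have [] := run_bounds (r i).
- have [ri bi] := rP i; have [_ hn] := run_bounds (r i) => qr.
  have qn : q.-1 < n.-1 by lia.
  have Eq : nat_of_ord (Ordinal qn) = q.-1 by [].
  have : Ordinal qn \in j.
    by rewrite (perm_mem jW); apply/mem_runs_word; exists (r i); rewrite ?Eq //; lia.
  case/tnthP => i' E; exists i'; first by rewrite -E Eq; lia.
  have [ri' bi'] := rP i'; case: (apart_mem es_apart ri ri') => [->//|].
  by rewrite -E Eq in bi'; rewrite /apart; lia.
- have [ri bi] := rP i; have [ri' bi'] := rP i'.
  case: (apart_mem es_apart ri ri') => [->|/orP[]]; first by constructor 1.
    by constructor 2.
  by constructor 3.
- by have [ri bi] := rP i; apply: forward_run.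
- by have [ri bi] := rP i; apply: backward_run.
rewrite wE cnt_word // => k; rewrite -(perm_mem jW) => /tnthP[i ->].
by rewrite eq_sym.
Qed.

End Product.

End Runs.

(** * Polytopes whose faces are the subcubes of a cube *)

Section Affine.

Local Open Scope ring_scope.
Local Open Scope classical_set_scope.

Variables (R : realType) (n : nat).
Implicit Types (g : 'rV[R]_n -> R).

(** The sign is chosen so that the inequality 0 <= g x has the form in which
    [faces] presents supporting half-spaces. *)
Definition affine g : Prop :=
  exists (c : 'rV[R]_n) (b : R), forall x, g x = b - \sum_k c 0 k * x 0 k.

Lemma affine_cst a : affine (fun _ => a).
Proof.
by exists 0, a => x; rewrite big1 ?subr0 // => k _; rewrite mxE mul0r.
Qed.

Lemma affineD g g' : affine g -> affine g' -> affine (fun x => g x + g' x).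
Proof.
move=> [c [b E]] [c' [b' E']]; exists (c + c'), (b + b') => x.
rewrite E E' addrACA -opprD -big_split; congr (_ - _).
by apply: eq_bigr => k _; rewrite mxE mulrDl.
Qed.

Lemma affineZ a g : affine g -> affine (fun x => a * g x).
Proof.
move=> [c [b E]]; exists (a *: c), (a * b) => x.
rewrite E mulrBr mulr_sumr; congr (_ - _).
by apply: eq_bigr => k _; rewrite mxE mulrA.
Qed.

Lemma affine_coord k : affine (fun x => x 0 k).
Proof.
exists (- delta_mx 0 k), 0 => x; rewrite sub0r -sumrN (bigD1 k) //= big1 => [|i ik].
  by rewrite !mxE !eqxx addr0 mulNr mul1r opprK.
by rewrite !mxE eqxx (negbTE ik) oppr0 mul0r oppr0.
Qed.

Lemma affine_sum (I : Type) (r : seq I) (p : pred I) (g : I -> 'rV[R]_n -> R) :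
  (forall i, affine (g i)) -> affine (fun x => \sum_(i <- r | p i) g i x).
Proof.
move=> ag; elim: r => [|i r [c [b E]]].
  by have [c [b E]] := affine_cst 0; exists c, b => x; rewrite big_nil; apply: E.
have [pi|npi] := boolP (p i); last first.
  by exists c, b => x; rewrite big_cons (negbTE npi).
have [c' [b' E']] := affineD (ag i) (ex_intro _ c (ex_intro _ b E)).
by exists c', b' => x; rewrite big_cons pi.
Qed.

Lemma affine_conv k (a : 'I_k -> 'rV[R]_n) (t : 'I_k -> R) g : affine g ->
  \sum_i t i = 1 -> g (\sum_i t i *: a i) = \sum_i t i * g (a i).
Proof.
move=> [c [b E]] t1; rewrite E -[b]mul1r -{1}t1 mulr_suml.
under [X in _ - X]eq_bigr => l _.
  rewrite summxE mulr_sumr; under eq_bigr => i _ do rewrite mxE mulrCA.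
  over.
rewrite exchange_big -sumrB; apply: eq_bigr => i _ /=.
by rewrite E mulrBr mulr_sumr.
Qed.

End Affine.

Section Cubical.

Local Open Scope ring_scope.
Local Open Scope classical_set_scope.

Variables (R : realType) (d : nat).

(** A combinatorial cube presented by d pairs of opposite facets: every choice of
    one facet in each pair has a common point lying on no other facet, and every
    supporting functional is tight at such a corner and is, up to a constant, a
    combination of the facets through it. *)
Record cubical n (P : set 'rV[R]_n) (phi : bool -> 'I_d -> 'rV[R]_n -> R) : Prop :=
  Cubical {
  facet_affine : forall b i, affine (phi b i);
  facet_ge0 : forall b i x, P x -> 0 <= phi b i x;
  corner : forall S : 'I_d -> bool, exists2 x, P x &
    forall b i, (phi b i x == 0) = (S i == b);
  supporting : forall (c : 'rV[R]_n) b,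
    (forall x, P x -> \sum_k c 0 k * x 0 k <= b) ->
    (exists2 x, P x & \sum_k c 0 k * x 0 k = b) ->
    exists (S : 'I_d -> bool) (t : 'I_d -> R), forall x, P x ->
      b - \sum_k c 0 k * x 0 k = \sum_i t i * phi (S i) i x }.

Definition subcube n (P : set 'rV[R]_n) (phi : bool -> 'I_d -> 'rV[R]_n -> R)
    (tau : 'I_d -> option bool) : set 'rV[R]_n :=
  P `&` [set x | forall i b, tau i = Some b -> phi b i x = 0].

Section Faces.

Variables (n : nat) (P : set 'rV[R]_n) (phi : bool -> 'I_d -> 'rV[R]_n -> R).
Hypothesis C : cubical P phi.

Local Notation sub := (subcube P phi).

(** A corner that satisfies tau and takes the other value wherever tau is free
    separates the two subcubes. *)
Lemma subcube_le tau tau' :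
  sub tau `<=` sub tau' <-> forall i b, tau' i = Some b -> tau i = Some b.
Proof.
split=> [le i b ti'|le x [Px tx]]; last first.
  by split=> // i b /le; apply: tx.
pose S k := if tau k is Some a then a else if k == i then ~~ b else false.
have [x Px xS] := corner C S.
have [|_ /(_ i b ti')/eqP] := le x.
  by split=> // k a tk; apply/eqP; rewrite xS /S tk.
by rewrite xS /S; case: (tau i) => [a /eqP -> //|]; rewrite eqxx; case: (b).
Qed.

Lemma subcube_neq0 tau : sub tau !=set0.
Proof.
have [x Px xS] := corner C (fun k => odflt false (tau k)).
by exists x; split=> // i b ti; apply/eqP; rewrite xS ti.
Qed.

(** A subcube is cut out by the sum of the facets that contain it. *)
Lemma subcube_face tau : faces P (sub tau).
Proof.
pose g x := \sum_(i < d) (if tau i is Some b then phi b i x else 0).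
have [c [b E]] : affine g.
  by apply: affine_sum => i; case: (tau i) => [b|];
    [apply: facet_affine C _ _ | apply: affine_cst].
have g0 i x : P x -> 0 <= (if tau i is Some b then phi b i x else 0).
  by move=> Px; case: (tau i) => // a; apply: (facet_ge0 C).
exists c, b; split=> [x Px|].
  by rewrite -subr_ge0 -E; apply: sumr_ge0 => i _; apply: g0.
apply/seteqP; split=> x [Px tx]; split=> //=.
  apply/esym/eqP; rewrite -subr_eq0 -E; apply/eqP/big1 => i _.
  by case Ei: (tau i) => [a|//]; apply: tx.
move=> i a ti; have : g x = 0 by rewrite E tx subrr.
move=> /eqP; rewrite psumr_eq0 => [/allP/(_ i (mem_index_enum _))|k _].
  by rewrite ti => /eqP.
exact: g0.
Qed.

(** At a corner that differs from S in direction i alone, only the i-th term of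
    the combination survives; it is nonnegative, so the i-th coefficient is. The
    face is then where all facets with nonzero coefficient vanish. *)
Lemma face_subcube F : faces P F -> F = set0 \/ exists tau, F = sub tau.
Proof.
move=> [c [b [le ->]]].
have [[x0 Px0 x0b]|no] := pselect (exists2 x, P x & \sum_k c 0 k * x 0 k = b);
  last first.
  by left; apply/seteqP; split=> // x [Px xb]; case: no; exists x.
right; have [S [t E]] := supporting C le (ex_intro2 _ _ _ Px0 x0b).
have t0 i : 0 <= t i.
  have [x Px xS] := corner C (fun k => S k (+) (k == i)).
  have pos : 0 < phi (S i) i x.
    by rewrite lt0r (facet_ge0 C) // xS eqxx addbT; case: (S i).
  have := le x Px; rewrite -subr_ge0 E // (bigD1 i) //= big1 => [|k ki].
    by rewrite addr0 pmulr_lge0.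
  by apply/eqP; rewrite mulf_eq0 xS (negbTE ki) addbF eqxx orbT.
exists (fun i => if t i == 0 then None else Some (S i)).
apply/seteqP; split=> x [Px xb]; split=> //.
  move=> i a /=; case: eqP => // /eqP ti [<-].
  have : \sum_i t i * phi (S i) i x = 0 by rewrite -E // xb subrr.
  move=> /eqP; rewrite psumr_eq0 => [/allP/(_ i (mem_index_enum _))|k _].
    by rewrite mulf_eq0 (negbTE ti) => /eqP.
  by rewrite mulr_ge0 ?(facet_ge0 C).
rewrite /=; apply/esym/eqP; rewrite -subr_eq0 E // big1 // => i _.
have [->|ti] := eqVneq (t i) 0; first by rewrite mul0r.
by rewrite xb ?mulr0 // (negbTE ti).
Qed.

Lemma face_set0 : faces P set0.
Proof.
exists 0, 1; split=> [x _|].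
  by rewrite big1 // => k _; rewrite mxE mul0r.
apply/seteqP; split=> // x [_] /=.
rewrite big1 => [/eqP|k _]; first by rewrite eq_sym oner_eq0.
by rewrite mxE mul0r.
Qed.

End Faces.

(** The face poset of either polytope consists of the empty face and the subcubes,
    and the inclusion of subcubes is read off tau alone. *)
Lemma cubical_comb_equiv n n' (P : set 'rV[R]_n) (Q : set 'rV[R]_n') phi psi :
  cubical P phi -> cubical Q psi -> comb_equiv P Q.
Proof.
move=> CP CQ;
pose f F := [set y | exists2 tau, F = subcube P phi tau & subcube Q psi tau y].
have f0 : f set0 = set0.
  apply/seteqP; split=> // y [tau E _].
  by have [x] := subcube_neq0 CP tau; rewrite -E.
have fS tau : f (subcube P phi tau) = subcube Q psi tau.
  apply/seteqP; split=> y; last by exists tau.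
  move=> [tau' E]; apply: (subcube_le CQ _ _).2; apply/(subcube_le CP).
  by rewrite E.
have fle F G : faces P F -> faces P G -> F `<=` G <-> f F `<=` f G.
  move=> /(face_subcube CP)[->|[tau ->]].
    by rewrite f0; split=> _; apply: sub0set.
  move=> /(face_subcube CP)[->|[tau' ->]]; rewrite ?f0 !fS.
    split=> le; [have [x /le //] := subcube_neq0 CP tau|].
    by have [x /le //] := subcube_neq0 CQ tau.
  exact: iff_trans (subcube_le CP _ _) (iff_sym (subcube_le CQ _ _)).
exists f => //; split.
- move=> _ /(face_subcube CP)[->|[tau ->]]; rewrite ?f0 ?fS.
    exact: face_set0.
  exact: subcube_face.
- move=> F G /set_mem FP /set_mem GP E; apply/seteqP.
  by split; apply/fle; rewrite // E.
move=> _ /(face_subcube CQ)[->|[tau ->]].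
  by exists set0; rewrite ?f0 //; apply: face_set0.
by exists (subcube P phi tau); rewrite ?fS //; apply: subcube_face.
Qed.

Definition cube_facet (b : bool) (i : 'I_d) (x : 'rV[R]_d) : R :=
  if b then 1 - x 0 i else x 0 i.

(** A linear functional c is maximal on the cube at the 0/1 vector S with S i = 1
    iff c i > 0, and the coefficients are the absolute values of the c i. *)
Lemma cubical_cube : cubical (cube R d) cube_facet.
Proof.
split.
- move=> [] i; last exact: affine_coord.
  have [c [b E]] := affineD (affine_cst d 1) (affineZ (-1) (affine_coord R i)).
  by exists c, b => x; rewrite -E mulN1r.
- by move=> [] i x /(_ i)/andP[]; rewrite /cube_facet ?subr_ge0.
- move=> S; exists (\row_i (S i)%:R) => [i|b i].
    by rewrite mxE; case: (S i); rewrite ?lexx ?ler01.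
  rewrite /cube_facet mxE; case: b; case: (S i); rewrite ?subrr ?subr0 ?eqxx //.
    by rewrite oner_eq0.
  by rewrite oner_eq0.
move=> c b le [y Py yb]; pose S i := 0 < c 0 i.
exists S, (fun i => `|c 0 i|) => x _.
have norm z i : `|c 0 i| * cube_facet (S i) i z = (S i)%:R * c 0 i - c 0 i * z 0 i.
  rewrite /S /cube_facet; case: ltP => [c0|c0].
    by rewrite gtr0_norm // mulrBr mulr1 mul1r.
  by rewrite ler0_norm // mul0r mulNr sub0r.
suff -> : b = \sum_i (S i)%:R * c 0 i.
  by rewrite -sumrB; apply: eq_bigr => i _; rewrite norm.
apply/eqP; rewrite eq_le; apply/andP; split.
  rewrite -yb -subr_ge0 -sumrB; apply: sumr_ge0 => i _; rewrite -norm.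
  have /andP[y0 y1] := Py i.
  by rewrite mulr_ge0 // /cube_facet; case: (S i); rewrite ?subr_ge0.
have := le (\row_i (S i)%:R); under eq_bigr do rewrite mxE mulrC; apply => i.
by rewrite mxE; case: (S i); rewrite ?lexx ?ler01.
Qed.

Section Hull.

Variables (n : nat) (T : Type) (V : set T) (x : T -> 'rV[R]_n).
Variables (lab : T -> 'I_d -> bool) (phi : bool -> 'I_d -> 'rV[R]_n -> R).
Hypothesis V_neq0 : V !=set0.
Hypothesis V_flip : forall z i, V z -> exists2 z', V z' &
  forall k, lab z' k = lab z k (+) (k == i).
Hypothesis phi_affine : forall b i, affine (phi b i).
Hypothesis phi_ge0 : forall b i z, V z -> 0 <= phi b i (x z).
Hypothesis phi_eq0 : forall b i z, V z -> (phi b i (x z) == 0) = (lab z i == b).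
Hypothesis phi_span : forall s (c : 'rV[R]_n), V s ->
  exists (t : 'I_d -> R) (a : R), forall z, V z ->
    \sum_k c 0 k * x z 0 k = a + \sum_i t i * phi (lab s i) i (x z).

(** Flips reach every label vector from any given vertex. *)
Lemma label_surj (S : 'I_d -> bool) : exists2 z, V z & lab z =1 S.
Proof.
have [z0 Vz0] := V_neq0.
have [N] := ubnP #|[pred i | lab z0 i != S i]|.
elim: N z0 Vz0 => // N IH z Vz; rewrite ltnS => le.
have [/existsP[i zi]|no] := boolP [exists i, lab z i != S i]; last first.
  by exists z => // i; move/existsPn: no => /(_ i); rewrite negbK => /eqP.
have [z' Vz' z'E] := V_flip i Vz; apply: IH Vz' _.
apply: leq_trans le; apply: proper_card; apply/properP; split.
  apply/fintype.subsetP => k; rewrite !inE z'E; have [->|_] := eqVneq k i.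
    by rewrite addbT.
  by rewrite addbF.
by exists i; rewrite !inE // z'E eqxx addbT; case: (lab z i) (S i) zi => [] [].
Qed.

(** A supporting functional is tight at some vertex, because a convex combination
    reaches the bound only if the vertices with positive weight do; and affine
    identities extend from the vertices to their hull. *)
Lemma cubical_hull : cubical (conv_hull (x @` V)) phi.
Proof.
have inP z : V z -> conv_hull (x @` V) (x z).
  move=> Vz; exists 1, (fun _ => x z), (fun _ => 1); split=> [i|i||].
  - by exists z.
  - exact: ler01.
  - by rewrite big_ord1.
  by rewrite big_ord1 scale1r.
split=> // [b i y [k [a [t [aV t0 t1 ->]]]]|S|c b le [y]].
- rewrite affine_conv //; apply: sumr_ge0 => l _; rewrite mulr_ge0 //.
  by have [z Vz <-] := aV l; apply: phi_ge0.
- have [z Vz zS] := label_surj S; exists (x z); first exact: inP.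
  by move=> b i; rewrite phi_eq0 // zS.
move=> [k [a [t [aV t0 t1 ->]]]] yb.
pose g (u : 'rV[R]_n) := b - \sum_k c 0 k * u 0 k.
have ag : affine g by exists c, b.
have g0 l : 0 <= g (a l).
  by have [z Vz <-] := aV l; rewrite subr_ge0; apply/le/inP.
have : \sum_l t l * g (a l) = 0 by rewrite -affine_conv // /g yb subrr.
move=> /eqP; rewrite psumr_eq0 => [/allP tg|l _]; last by rewrite mulr_ge0.
have [l tl] : exists l, t l != 0.
  apply/existsP; apply: contraPT t1 => /existsPn no; rewrite big1 => [/eqP|l _].
    by rewrite eq_sym oner_eq0.
  by have := no l; rewrite negbK => /eqP.
have := tg l (mem_index_enum _); rewrite /= mulf_eq0 (negbTE tl) /=.
have [s Vs <-] := aV l; rewrite subr_eq0 => /eqP sb.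
have [r [e E]] := phi_span c Vs.
exists (lab s), (fun i => - r i) => u [k' [a' [t' [a'V t'0 t'1 ->]]]].
pose g' (u : 'rV[R]_n) := \sum_i - r i * phi (lab s i) i u.
have ag' : affine g' by apply: affine_sum => i; apply: affineZ.
rewrite -/(g _) -/(g' _) !affine_conv //; apply: eq_bigr => l' _; congr (_ * _).
have [z Vz <-] := a'V l'; rewrite /g /g' sb !E // [X in e + X - _]big1 => [|i _].
  by rewrite addr0 opprD addNKr -sumrN; apply: eq_bigr => i _; rewrite mulNr.
by apply/eqP; rewrite mulf_eq0 phi_eq0 // eqxx orbT.
Qed.

Lemma hull_comb_equiv_cube : comb_equiv (conv_hull (x @` V)) (cube R d).
Proof. exact: cubical_comb_equiv cubical_hull cubical_cube. Qed.

End Hull.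

End Cubical.

(** * Facets of the Bruhat interval polytope *)

Lemma sum_ord_interval (V : nmodType) n a b (F : nat -> V) : b <= n ->
  (\sum_(q < n | (a <= q < b)%N) F q = \sum_(a <= q < b) F q)%R.
Proof.
move=> bn; rewrite [RHS](big_nat_widen _ _ n) // (big_nat_widenl _ 0) // big_mkord.
by apply: eq_bigl => q; rewrite andbC.
Qed.

Section Span.

Local Open Scope ring_scope.
Local Open Scope classical_set_scope.

Variables (R : realType) (T : Type) (V : set T) (m : nat) (Phi : 'I_m -> T -> R).

Definition spanned (F : T -> R) : Prop :=
  exists (t : 'I_m -> R) (e : R), forall z, V z -> F z = e + \sum_i t i * Phi i z.

Lemma eq_spanned F F' : (forall z, V z -> F z = F' z) -> spanned F -> spanned F'.
Proof. by move=> E [t [e H]]; exists t, e => z Vz; rewrite -E ?H. Qed.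

Lemma spanned_cst a : spanned (fun _ => a).
Proof.
by exists (fun _ => 0), a => z _; rewrite big1 ?addr0 // => i _; rewrite mul0r.
Qed.

Lemma spanned_Phi i : spanned (Phi i).
Proof.
exists (fun k => (k == i)%:R), 0 => z _; rewrite (bigD1 i) //= eqxx mul1r.
by rewrite big1 ?addr0 ?add0r // => k /negbTE ->; rewrite mul0r.
Qed.

Lemma spanned_lin a F F' : spanned F -> spanned F' ->
  spanned (fun z => a * F z + F' z).
Proof.
move=> [t [e H]] [t' [e' H']]; exists (fun i => a * t i + t' i), (a * e + e').
move=> z Vz; rewrite H // H' // mulrDr addrACA mulr_sumr -big_split.
by congr (_ + _); apply: eq_bigr => i _; rewrite mulrDl mulrA.
Qed.

Lemma spannedB F F' : spanned F -> spanned F' -> spanned (fun z => F z - F' z).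
Proof.
move=> s s'; apply: eq_spanned (spanned_lin (-1) s' s) => z _.
by rewrite mulN1r addrC.
Qed.

Lemma spanned_sum (I : Type) (r : seq I) (c : I -> R) (F : I -> T -> R) :
  (forall i, spanned (F i)) -> spanned (fun z => \sum_(i <- r) c i * F i z).
Proof.
move=> s; elim: r => [|i r IH].
  by apply: eq_spanned (spanned_cst 0) => z _; rewrite big_nil.
by apply: eq_spanned (spanned_lin (c i) (s i) IH) => z _; rewrite big_cons.
Qed.

End Span.

Section Polytopes.

Local Open Scope ring_scope.
Local Open Scope classical_set_scope.

Variables (R : realType) (n m : nat) (v w : 'S_n) (lnk : 'I_m -> nat).
Variable blk : 'I_m -> block.
Hypothesis B : blocks_spec v w lnk blk.

Local Notation L i := (blo (blk i)).
Local Notation H i := (bhi (blk i)).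
Local Notation fwd i := (bfwd (blk i)).
Local Notation V := [set z : 'S_n | in_interval v w blk z].
Local Notation lab := (lab v w lnk blk).
Local Notation bkey i := (key blk i (base v w blk i)).
Local Notation lft i := (prev_smaller (bkey i) (lnk i)).
Local Notation rgt i := (next_smaller (bkey i) (H i) (lnk i)).

Lemma lft_rgt i : [/\ L i <= lft i, lft i < lnk i, lnk i < rgt i & rgt i <= (H i).+1]%N.
Proof.
have [/andP[? ?] _ _] :=
  prev_smaller_spec (base_inj B (i := i)) (base_min B (i := i)) (lnk_blk B i).
have [/andP[? ?] _ _] :=
  next_smaller_spec (base_inj B (i := i)) (lnk_blk B i).
by split.
Qed.

Section Point.

Variables (Phi : 'I_m -> 'S_n -> R) (s : 'S_n) (Y : 'S_n -> nat -> R).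

Local Notation span := (spanned V Phi).

(** Each window contributes, through the facet selected by the label of s, the sum
    of Y over one of its halves; the tree of windows does the rest. *)
Lemma spanned_point i :
  span (fun z => \sum_(L i <= q < (H i).+1) Y z q) ->
  (forall i', blk i' = blk i ->
    if lab s i' then span (fun z => \sum_(lft i' <= q < lnk i') Y z q)
    else span (fun z => \sum_(lnk i' <= q < rgt i') Y z q)) ->
  forall p, (L i <= p <= H i)%N -> span (Y ^~ p).
Proof.
move=> whole half p pLH.
suff: span (fun z => \sum_(p <= q < p.+1) Y z q).
  by apply: eq_spanned => z _; rewrite big_nat1.
apply: (@interval_point _ _ _ (base_inj B (i := i)) (base_min B (i := i))
  (fun a b => span (fun z => \sum_(a <= q < b) Y z q))) => //.
- move=> a b c /andP[ab bc] sac sbc; apply: eq_spanned (spannedB sac sbc) => z _.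
  by rewrite (big_cat_nat ab bc) /= addrK.
- move=> a b c /andP[ab bc] sac sab; apply: eq_spanned (spannedB sac sab) => z _.
  by rewrite (big_cat_nat ab bc) /= addrAC subrr add0r.
move=> j /(blk_lnk B)[i' <- Ei]; have := half i' Ei.
by rewrite /key /base Ei; case: (lab s i'); [right | left].
Qed.

End Point.

(** The key of a value, read off the coordinate of the vertex, which is the value
    plus one. *)
Definition key_coord i (r : R) : R := if fwd i then r - 1 else n.-1%:R - (r - 1).

(** The facets for right multiplication, where the coordinates are the values of
    z; compare [sum_right_key] and [sum_left_key]. *)
Definition right_facet (b : bool) i (x : 'rV[R]_n) : R :=
  if b then (\sum_((lft i).+1 <= q < (lnk i).+1) bkey i q)%N%:R
    - \sum_(q < n | (lft i <= q < lnk i)%N) key_coord i (x 0 q)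
  else (\sum_(lnk i <= q < rgt i) bkey i q)%N%:R
    - \sum_(q < n | (lnk i <= q < rgt i)%N) key_coord i (x 0 q).

Lemma key_coordE i (z : 'S_n) (q : 'I_n) :
  key_coord i (perm_point R z 0 q) = (key blk i z q)%:R.
Proof.
rewrite /key_coord mxE /key evE -natr1 addrK.
by case: ifP => // _; rewrite natrB // -ltnS prednK // (leq_ltn_trans _ (ltn_ord q)).
Qed.

Lemma sum_key_coord i (z : 'S_n) a b : (b <= n)%N ->
  \sum_(q < n | (a <= q < b)%N) key_coord i (perm_point R z 0 q) =
  (\sum_(a <= q < b) key blk i z q)%N%:R.
Proof.
move=> bn; rewrite (eq_bigr _ (fun q _ => key_coordE i z q)).
by rewrite (sum_ord_interval a (fun q => (key blk i z q)%:R)) // natr_sum.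
Qed.

Lemma leqif_subr (a b : nat) c : (a <= b ?= iff c)%N ->
  0 <= b%:R - a%:R :> R /\ (b%:R - a%:R == 0 :> R) = c.
Proof. by move=> [le <-]; rewrite subr_ge0 ler_nat le subr_eq0 eqr_nat eq_sym. Qed.

Lemma right_facetP b i z : V z ->
  0 <= right_facet b i (perm_point R z) /\
  (right_facet b i (perm_point R z) == 0) = (lab z i == b).
Proof.
move=> [za zo]; have Hn := bhi_lt B i; have [l1 l2 l3 l4] := lft_rgt i.
have Ij := lnk_blk B i.
rewrite /right_facet; case: b.
  rewrite sum_key_coord; last by lia.
  rewrite eqb_id; apply: leqif_subr.
  exact: (sum_left_key (base_inj B (i := i)) (base_min B (i := i)) (za i) Ij).
rewrite sum_key_coord; last by lia.
rewrite eqbF_neg; apply: leqif_subr.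
exact: (sum_right_key (base_inj B (i := i)) (base_min B (i := i)) (za i) Ij).
Qed.

Lemma affine_key_coord i q : affine (fun x : 'rV[R]_n => key_coord i (x 0 q)).
Proof.
have [c [b E]] : affine (fun x : 'rV[R]_n =>
    (if fwd i then 1 else -1) * (x 0 q) + (if fwd i then -1 else n.-1%:R + 1)).
  by apply: affineD (affine_cst _ _); apply: affineZ; apply: affine_coord.
by exists c, b => x; rewrite -E /key_coord; case: (fwd i); ring.
Qed.

Lemma affine_right_facet b i : affine (right_facet b i).
Proof.
have aff C (P : pred 'I_n) : affine (fun x : 'rV[R]_n =>
    C - \sum_(q < n | P q) key_coord i (x 0 q)).
  have [c [a E]] : affine (fun x : 'rV[R]_n =>
      C + (-1) * \sum_(q < n | P q) key_coord i (x 0 q)).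
    apply: affineD (affine_cst _ _) _; apply: affineZ; apply: affine_sum => q.
    exact: affine_key_coord.
  by exists c, a => x; rewrite -E mulN1r.
by case: b; apply: aff.
Qed.

Lemma blockP (p : 'I_n) :
  (exists i, L i <= p <= H i)%N \/ forall i, ~~ (L i <= p <= H i)%N.
Proof.
have [/existsP|no] := boolP [exists i, (L i <= p <= H i)%N]; first by left.
by right=> i; move/existsPn: no; apply.
Qed.

Lemma eq_blk_key i i' : blk i' = blk i ->
  @key n m blk i' =2 key blk i /\ base v w blk i' = base v w blk i.
Proof. by move=> E; rewrite /key /base E. Qed.

Lemma right_span s (c : 'rV[R]_n) : V s -> exists (t : 'I_m -> R) (a : R),
  forall z, V z -> \sum_k c 0 k * perm_point R z 0 k =
    a + \sum_i t i * right_facet (lab s i) i (perm_point R z).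
Proof.
move=> Vs; pose Phi i (z : 'S_n) := right_facet (lab s i) i (perm_point R z).
apply: (@spanned_sum _ _ V _ Phi _ _ (fun k => c 0 k)
  (fun k z => perm_point R z 0 k)) => p.
have [[i pi]|off] := blockP p; last first.
  apply: eq_spanned (spanned_cst V Phi (ev v p).+1%:R) => z [_ zo].
  by rewrite mxE -evE zo.
have sp : spanned V Phi (fun z => (key blk i z p)%:R).
  apply: (@spanned_point Phi s (fun z q => (key blk i z q)%:R) i) => //.
    apply: eq_spanned (spanned_cst V Phi (\sum_(L i <= q < (H i).+1) bkey i q)%N%:R).
    by move=> z [za _]; rewrite -(sum_block id (za i)) natr_sum.
  move=> i' Ei; have [Ek _] := eq_blk_key Ei.
  have Hn := bhi_lt B i'; have [l1 l2 l3 l4] := lft_rgt i'.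
  have Ij := lnk_blk B i'.
  case Es: (lab s i').
    apply: eq_spanned (spannedB (spanned_cst V Phi
      (\sum_((lft i').+1 <= q < (lnk i').+1) bkey i' q)%N%:R)
      (spanned_Phi V Phi i')) => z _.
    rewrite /Phi /right_facet Es sum_key_coord; last by lia.
    rewrite subKr natr_sum; apply: eq_bigr => q _; congr (_%:R); exact: Ek.
  apply: eq_spanned (spannedB (spanned_cst V Phi
    (\sum_(lnk i' <= q < rgt i') bkey i' q)%N%:R)
    (spanned_Phi V Phi i')) => z _.
  rewrite /Phi /right_facet Es sum_key_coord; last by lia.
  by rewrite subKr natr_sum; apply: eq_bigr => q _; congr (_%:R); exact: Ek.
apply: eq_spanned (spanned_lin (if fwd i then 1 else -1) sp
  (spanned_cst V Phi (if fwd i then 1 else n.-1%:R + 1))) => z _.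
rewrite -key_coordE /key_coord; case: (fwd i); ring.
Qed.

Lemma in_interval_flip z i : V z ->
  exists2 z', V z' & forall k, lab z' k = lab z k (+) (k == i).
Proof.
move=> Vz; have [a [b [_ Vz' E _]]] := interval_flip B i Vz.
by exists (perm_comp z (tperm a b)).
Qed.

Lemma right_polytope : comb_equiv (conv_hull (@perm_point R n @` V)) (cube R m).
Proof.
apply: (@hull_comb_equiv_cube _ _ _ _ _ _ lab right_facet).
- by exists v; have [] := in_interval_ends B.
- exact: in_interval_flip.
- exact: affine_right_facet.
- by move=> b i z /(right_facetP b i)[].
- by move=> b i z /(right_facetP b i)[].
exact: right_span.
Qed.

(** The facets for left multiplication, where the coordinates are the values of
    the inverse of z; compare [sum_right_pos] and [sum_left_pos]. *)
Definition left_facet (b : bool) i (x : 'rV[R]_n) : R :=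
  if b then \sum_(q < n | (lft i < q < (lnk i).+1)%N) (x 0 (base v w blk i q) - 1)
      - (\sum_(lft i <= q < lnk i) q)%N%:R
  else (\sum_(lnk i <= q < rgt i) q)%N%:R
    - \sum_(q < n | (lnk i <= q < rgt i)%N) (x 0 (base v w blk i q) - 1).

Definition key_pos i (z : 'S_n) (a : nat) : nat :=
  ev z^-1 (if fwd i then a else n.-1 - a)%N.

Lemma key_posE i (z u : 'S_n) q : (q < n)%N ->
  key_pos i z (key blk i u q) = ev z^-1 (ev u q).
Proof.
move=> qn; rewrite /key_pos /key; case: (fwd i) => //; congr ev.
by have := ev_lt u q; lia.
Qed.

Lemma sum_left_coord i (z : 'S_n) a b : (b <= n)%N ->
  \sum_(q < n | (a <= q < b)%N) (perm_point R z^-1 0 (base v w blk i q) - 1) =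
  (\sum_(a <= q < b) key_pos i z (bkey i q))%N%:R.
Proof.
move=> bn; rewrite natr_sum.
rewrite -(sum_ord_interval _ (fun q => (key_pos i z (bkey i q))%:R) bn).
apply: eq_bigr => q _; rewrite key_posE // mxE -natr1 addrK.
by rewrite !evE.
Qed.

Lemma left_facetP b i z : V z ->
  0 <= left_facet b i (perm_point R z^-1) /\
  (left_facet b i (perm_point R z^-1) == 0) = (lab z i == b).
Proof.
move=> [za zo]; have Hn := bhi_lt B i; have [l1 l2 l3 l4] := lft_rgt i.
have Ij := lnk_blk B i.
have posK q : (L i <= q <= H i)%N -> key_pos i z (key blk i z q) = q.
  by move=> ?; rewrite key_posE ?evK //; lia.
rewrite /left_facet; case: b.
  rewrite sum_left_coord; last by lia.
  rewrite eqb_id; apply: leqif_subr.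
  exact: (sum_left_pos (base_inj B (i := i)) (base_min B (i := i)) (za i) Ij posK).
rewrite sum_left_coord; last by lia.
rewrite eqbF_neg; apply: leqif_subr.
exact: (sum_right_pos (base_inj B (i := i)) (base_min B (i := i)) (za i) Ij posK).
Qed.

Lemma affine_left_facet b i : affine (left_facet b i).
Proof.
have aff a C (P : pred 'I_n) : affine (fun x : 'rV[R]_n =>
    a * (\sum_(q < n | P q) (x 0 (base v w blk i q) - 1)) + C).
  apply: affineD (affine_cst _ _); apply: affineZ; apply: affine_sum => q.
  exact: affineD (affine_coord _ _) (affine_cst _ _).
case: b.
  have [c [a E]] := aff 1 (- (\sum_(lft i <= q < lnk i) q)%N%:R)
    (fun q : 'I_n => (lft i < q < (lnk i).+1)%N).
  by exists c, a => x; rewrite -E mul1r.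
have [c [a E]] := aff (-1) (\sum_(lnk i <= q < rgt i) q)%N%:R
  (fun q : 'I_n => (lnk i <= q < rgt i)%N).
by exists c, a => x; rewrite -E mulN1r addrC.
Qed.

(** The facets through s involve sets of values. Pulled back along s they become
    the halves of windows again, since s maps the designated half of each window
    onto the set of values of its facet ([sum_left_eq], [sum_right_eq]). *)
Lemma left_span s (c : 'rV[R]_n) : V s -> exists (t : 'I_m -> R) (a : R),
  forall z, V z -> \sum_k c 0 k * perm_point R z^-1 0 k =
    a + \sum_i t i * left_facet (lab s i) i (perm_point R z^-1).
Proof.
move=> Vs; have [sa so] := Vs.
pose Phi i (z : 'S_n) := left_facet (lab s i) i (perm_point R z^-1).
suff: spanned V Phi (fun z => \sum_p c 0 (s p) * perm_point R z^-1 0 (s p)).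
  by apply: eq_spanned => z _; rewrite [RHS](reindex_inj (@perm_inj _ s)).
apply: (@spanned_sum _ _ V _ Phi _ _ (fun p => c 0 (s p))
  (fun p z => perm_point R z^-1 0 (s p))) => p.
have [[i pi]|off] := blockP p; last first.
  apply: eq_spanned (spanned_cst V Phi p.+1%:R) => z [_ zo].
  by rewrite mxE -!evE so // -zo // evK.
have sp : spanned V Phi (fun z => (ev z^-1 (ev s p))%:R).
  apply: (@spanned_point Phi s (fun z q => (ev z^-1 (ev s q))%:R) i) => //.
    have Hn := bhi_lt B i.
    apply: eq_spanned (spanned_cst V Phi (\sum_(L i <= q < (H i).+1) q)%N%:R).
    move=> z [za _]; rewrite -natr_sum; congr (_%:R).
    have := sum_block (key_pos i z) (za i).
    rewrite -(sum_block (key_pos i z) (sa i)) => E.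
    transitivity (\sum_(L i <= q < (H i).+1) key_pos i z (key blk i z q))%N.
      by apply: eq_big_nat => q ?; rewrite key_posE ?evK //; lia.
    by rewrite E; apply: eq_big_nat => q ?; rewrite key_posE //; lia.
  move=> i' Ei.
  have Hn := bhi_lt B i'; have [l1 l2 l3 l4] := lft_rgt i'.
  have Ij := lnk_blk B i'.
  have Es0 q : (q < n)%N -> forall z, key_pos i' z (key blk i' s q) = ev z^-1 (ev s q).
    by move=> qn z; rewrite key_posE.
  case Es: (lab s i').
    apply: eq_spanned (spanned_lin 1 (spanned_Phi V Phi i')
      (spanned_cst V Phi (\sum_(lft i' <= q < lnk i') q)%N%:R)) => z _.
    rewrite /Phi /left_facet Es sum_left_coord; last by lia.
    rewrite mul1r subrK -natr_sum; congr (_%:R).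
    rewrite -(sum_left_eq (base_inj B (i := i')) (base_min B (i := i')) (sa i')
      Ij (key_pos i' z) Es).
    by apply: eq_big_nat => q ?; rewrite key_posE //; lia.
  apply: eq_spanned (spannedB (spanned_cst V Phi
    (\sum_(lnk i' <= q < rgt i') q)%N%:R) (spanned_Phi V Phi i')) => z _.
  rewrite /Phi /left_facet Es sum_left_coord; last by lia.
  rewrite subKr -natr_sum; congr (_%:R).
  rewrite -(sum_right_eq (base_inj B (i := i')) (base_min B (i := i')) (sa i')
    Ij (key_pos i' z) (negbT Es)).
  by apply: eq_big_nat => q ?; rewrite key_posE //; lia.
apply: eq_spanned (spanned_lin 1 sp (spanned_cst V Phi 1)) => z _.
by rewrite mul1r mxE -natr1 !evE.
Qed.

Lemma left_polytope :
  comb_equiv (conv_hull ((fun z => perm_point R z^-1%g) @` V)) (cube R m).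
Proof.
apply: (@hull_comb_equiv_cube _ _ _ _ _ _ lab left_facet).
- by exists v; have [] := in_interval_ends B.
- exact: in_interval_flip.
- exact: affine_left_facet.
- by move=> b i z /(left_facetP b i)[].
- by move=> b i z /(left_facetP b i)[].
exact: left_span.
Qed.

End Polytopes.

(** * The theorem *)

Section ReversedRuns.

Variable n : nat.
Implicit Types (e f : 'I_n.-1 * 'I_n.-1) (es : seq ('I_n.-1 * 'I_n.-1)).

(** The runs of the inverse permutation. *)
Definition reverse_runs es := rev (map (fun e => (e.2, e.1)) es).

Lemma run_word_swap e : run_word (e.2, e.1) = rev (run_word e).
Proof.
have segC : seg (e.2, e.1) = seg e by rewrite /seg /= minnC maxnC.
rewrite /run_word segC /=; case: ltngtP => [lt|lt|/val_inj E].
- by rewrite revK.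
- by [].
have : size (seg e) = 1.
  by rewrite -(size_map val) val_seg size_iota /run_block /= E minnn maxnn subSnn.
by case: (seg e) => [|k [|]].
Qed.

Lemma runs_word_reverse es : runs_word (reverse_runs es) = rev (runs_word es).
Proof.
elim: es => //= e es IH; rewrite /reverse_runs /= rev_cons -cats1.
rewrite /runs_word map_cat flatten_cat -/(runs_word _) IH /= cats0.
by rewrite run_word_swap rev_cat.
Qed.

Lemma apart_reverse es :
  pairwise (@apart n) es -> pairwise (@apart n) (reverse_runs es).
Proof.
elim: es => //= e es IH /andP[ae aes].
rewrite /reverse_runs /= rev_cons pairwise_rcons IH // andbT all_rev all_map.
apply: sub_all ae => f /=.
by rewrite apart_sym /apart /run_block /= !(minnC f.2) !(maxnC f.2)
  !(minnC e.2) !(maxnC e.2).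
Qed.

End ReversedRuns.

Theorem proposition7p3 (R : realType) (n m : nat) (v w : 'S_n)
    (j : m.-tuple 'I_n.-1) :
  uniq j ->
  proper_product j ->
  w = perm_comp v (simple_word j) \/ w = perm_comp (simple_word j) v ->
  perm_length w = (perm_length v + m)%N ->
  exists d : nat, comb_equiv (bruhat_polytope R v w) (cube R d).
Proof.
move=> uj [es [[E dis] _] nadj] w_eq w_len; exists m.
have ap := runs_apart dis nadj; rewrite runs_wordE in E.
have jW : perm_eq j (runs_word es) by apply: mem_word; rewrite ?runs_word_uniq.
have sW : size (runs_word es) = m by rewrite -(perm_size jW) size_tuple.
case: w_eq => wE.
  have [||blk B] := @runs_blocks n v w es ap _ _ m j jW.
  - by rewrite wE E.
  - by rewrite sW.
  rewrite /bruhat_polytope (_ : [set z | bruhat v z /\ bruhat z w] =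
    [set z | in_interval v w blk z])%classic.
    exact: right_polytope B.
  by apply/seteqP; split=> z /(in_intervalP B).
have ap' := apart_reverse ap.
have jW' : perm_eq j (runs_word (reverse_runs es)).
  by rewrite runs_word_reverse (perm_trans jW) // perm_sym perm_rev.
have [||blk B] := @runs_blocks n v^-1 w^-1 _ ap' _ _ m j jW'.
- by rewrite runs_word_reverse simple_word_rev -E wE /perm_comp invMg.
- by rewrite !perm_length_inv runs_word_reverse size_rev sW.
rewrite (_ : bruhat_polytope R v w =
    conv_hull ((fun z => perm_point R z^-1%g) @`
      [set z | in_interval v^-1 w^-1 blk z])%classic).
  exact: left_polytope B.
rewrite /bruhat_polytope; congr conv_hull; apply/seteqP; split=> u [z].
  move=> [vz zw] <-; exists (z^-1)%g; last by rewrite invgK.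
  by apply/(in_intervalP B); split; apply: bruhat_inv.
move=> /(in_intervalP B)[vz zw] <-; exists (z^-1)%g => //.
by split; [rewrite -[v]invgK | rewrite -[w]invgK]; apply: bruhat_inv.
Qed.
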